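(* Let $n\ge 2$, let $d\ge 2$ be an even integer, and let $f$ be a form of degree $d$ in $n$ variables such that $y^TH_f(x)y>0$ for all $(x,y)\in S^{n-1}\times S^{n-1}$. Define $$\eta(f)=\frac{\min\{y^TH_f(x)y : (x,y)\in S^{n-1}\times S^{n-1}\}}{\max\{y^TH_f(x)y : (x,y)\in S^{n-1}\times S^{n-1}\}}.$$ If $r$ is a nonnegative integer with $r\ge \frac{n(d-2)(d-3)}{4\log(2)\,\eta(f)}-\frac{n+d-2}{2}-d$ (natural logarithm), then $f$ is $r$-sos-convex.
   Context: $S^{n-1}$ is the unit sphere in $\mathbb{R}^n$ and $H_f(x)$ is the Hessian matrix of $f$ at $x$. A polynomial is a sum of squares (sos) if it equals $\sum_i q_i^2$ for some polynomials $q_i$. For a nonnegative integer $r$, a polynomial $f$ in $x=(x_1,\dots,x_n)$ is called $r$-sos-convex if the polynomial $y^TH_f(x)y\cdot\left(\sum_{i=1}^n x_i^2\right)^r$ in the variables $(x,y)\in\mathbb{R}^{2n}$ is a sum of squares. *)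

(* Defs.v *)
From Stdlib Require Import Reals List Arith.
Import ListNotations.
Open Scope R_scope.

Definition sumR (n : nat) (g : nat -> R) : R :=
  fold_right Rplus 0 (map g (seq 0 n)).
Definition prodR (n : nat) (g : nat -> R) : R :=
  fold_right Rmult 1 (map g (seq 0 n)).

(* A monomial c * x_0^a_0 * ... ; a polynomial is a finite list (sum) of them.
   A polynomial "in n variables" is evaluated on x_0..x_{n-1}. *)
Definition monom : Type := (R * (nat -> nat))%type.
Definition mpoly : Type := list monom.

Definition eval_mon (n : nat) (m : monom) (x : nat -> R) : R :=
  fst m * prodR n (fun i => x i ^ (snd m i)).
Definition eval (n : nat) (p : mpoly) (x : nat -> R) : R :=
  fold_right Rplus 0 (map (fun m => eval_mon n m x) p).

Definition dmon (i : nat) (m : monom) : monom :=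
  (fst m * INR (snd m i),
   fun j => if Nat.eqb j i then (snd m j - 1)%nat else snd m j).
Definition dpoly (i : nat) (p : mpoly) : mpoly := map (dmon i) p.

Definition is_form (n d : nat) (f : mpoly) : Prop :=
  forall m, In m f -> fold_right plus 0%nat (map (snd m) (seq 0 n)) = d.

Definition hessian (n : nat) (f : mpoly) (i j : nat) (x : nat -> R) : R :=
  eval n (dpoly i (dpoly j f)) x.
Definition hess_form (n : nat) (f : mpoly) (x y : nat -> R) : R :=
  sumR n (fun i => sumR n (fun j => y i * hessian n f i j x * y j)).

Definition on_sphere (n : nat) (x : nat -> R) : Prop :=
  sumR n (fun i => x i ^ 2) = 1.

Definition pair_vec (n : nat) (x y : nat -> R) : nat -> R :=
  fun k => if Nat.ltb k n then x k else y (k - n)%nat.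

Definition is_sos_2n (n : nat) (P : (nat -> R) -> (nat -> R) -> R) : Prop :=
  exists qs : list mpoly, forall x y : nat -> R,
    P x y = fold_right Rplus 0
              (map (fun q => (eval (2 * n) q (pair_vec n x y)) ^ 2) qs).

Definition r_sos_convex (n r : nat) (f : mpoly) : Prop :=
  is_sos_2n n (fun x y => hess_form n f x y * (sumR n (fun i => x i ^ 2)) ^ r).

Definition is_min_on_sphere2 (n : nat) (g : (nat -> R) -> (nat -> R) -> R) (m : R) : Prop :=
  (exists x y, on_sphere n x /\ on_sphere n y /\ g x y = m) /\
  (forall x y, on_sphere n x -> on_sphere n y -> m <= g x y).
Definition is_max_on_sphere2 (n : nat) (g : (nat -> R) -> (nat -> R) -> R) (M : R) : Prop :=
  (exists x y, on_sphere n x /\ on_sphere n y /\ g x y = M) /\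
  (forall x y, on_sphere n x -> on_sphere n y -> g x y <= M).

(* Main.v *)
(* Let E be the average over a standard Gaussian vector g, and m = d - 2. For a
   form p of degree m, E (p(g) <g, x>^(m + 2r)) is a combination of the
   |x|^(2 (r + k)) lap^k p(x), and this operator can be inverted explicitly:
     |x|^(2r) p(x) = c E ((Psi p)(g) <g, x>^(m + 2r)).
   For p = y^T H_f y, if Psi p >= 0 for all y, then the right-hand side is an
   average of squares, that is, a positive semidefinite quadratic form in the
   monomials of degree m / 2 + r in x and 1 in y, hence a sum of squares.
   Restricting p to great circles, the Markov inequality bounds |lap p| on the
   sphere by n m (m - 1) max |p|, and Psi p >= 0 follows for m >= 4 from the
   hypothesis on r; this uses only ln 2 <= 7 / 10 and max >= (d - 1) min.
   For d = 4 this is too weak, and the Laplacian is bounded with the symmetry of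
   the 4-linear form of f instead. What remains is n = 2, and n = 3 with
   max / min <= 63 / 20; there the form X |-> sum X_ik X_jl f_ikjl is positive
   semidefinite, so that y^T H_f y itself is a sum of squares. *)

Require Import Defs.
From Stdlib Require Import Reals List Arith.
Open Scope R_scope.

(** The average [gauss_E] is defined by its moments, with no integral behind it. Its identities come
    from Gaussian integration by parts, which on monomials is just the recurrence of the moments,
    combined with Euler's identity. Only its positivity needs a limit: rescaled simple random walks,
    one per coordinate, have moments that converge to the Gaussian ones, so [gauss_E p] is a limit
    of averages of values of [p].

    The case d = 4 is delicate because c |x|^4 attains max = 3 min, the least ratio that is
    possible, and near this ratio the hypothesis on r is weakest. With ln 2 <= 7 / 10 and n = 3, it
    yields the condition of the improved Laplacian bound exactly when max / min >= 28 / 9. On the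
    other side, as long as max / min <= 16 / 5, the estimates put each coefficient of the 4-linear
    form within min / 5 of that of (min / 4) |x|^4, and 2 / 9 instead of 1 / 5 would still give a
    semidefinite form on 3 x 3 matrices. The constant 63 / 20 is a choice between 28 / 9 and 16 /
    5. *)

Module SosConvexity.

From HB Require Import structures.
From mathcomp Require Import all_boot all_order all_algebra.
From mathcomp.multinomials Require Import ssrcomplements mpoly.
From mathcomp Require Import bigenough.
From mathcomp Require Import ring lra zify.
Set Implicit Arguments.
Unset Strict Implicit.
Unset Printing Implicit Defensive.
Import Order.TTheory GRing.Theory Num.Theory BigEnough.
Local Open Scope ring_scope.
From mathcomp Require Import reals Rstruct.

(** * Forms and differential operators *)

Lemma sum_delta (R : pzSemiRingType) (I : finType) (i : I) (F : I -> R) :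
  \sum_j (i == j)%:R * F j = F i.
Proof.
rewrite (bigD1 i) //= eqxx mul1r big1 ?addr0 // => j /negbTE.
by rewrite eq_sym => ->; rewrite mul0r.
Qed.

Section Forms.
Variables (n : nat) (R : realFieldType).
Implicit Types (p q : {mpoly R[n]}) (v x : 'I_n -> R).

Definition dird v p := \sum_i v i *: p^`M(i).
Definition lap p := \sum_i p^`M(i)^`M(i).
Definition nrm2 : {mpoly R[n]} := \sum_i 'X_i ^+ 2.
Definition linform v : {mpoly R[n]} := \sum_i v i *: 'X_i.
Definition sqnorm v := \sum_i v i ^+ 2.
Definition dot v w := \sum_(i < n) v i * w i : R.

(* Homogeneity of degree [c], expressed by Euler's identity; [c] ranges over
   [R], so that differentiating a constant is no exception. *)
Definition euler (c : R) p := \sum_i 'X_i * p^`M(i) = c *: p.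

Lemma dird_is_linear v : linear (dird v).
Proof.
move=> c p q; rewrite /dird scaler_sumr -big_split /=.
by apply: eq_bigr => i _; rewrite linearP /= scalerDr !scalerA mulrC.
Qed.
HB.instance Definition _ v := GRing.isLinear.Build R {mpoly R[n]} {mpoly R[n]}
  _ (dird v) (dird_is_linear v).

Lemma lap_is_linear : linear lap.
Proof.
move=> c p q; rewrite /lap scaler_sumr -big_split /=.
by apply: eq_bigr => i _; rewrite !linearP.
Qed.
HB.instance Definition _ := GRing.isLinear.Build R {mpoly R[n]} {mpoly R[n]}
  _ lap lap_is_linear.

Lemma dird_mderiv v i p : dird v p^`M(i) = (dird v p)^`M(i).
Proof.
rewrite /dird linear_sum; apply: eq_bigr => j _.
by rewrite linearZ /= mderiv_comm.
Qed.

Lemma dirdC v w p : dird v (dird w p) = dird w (dird v p).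
Proof.
rewrite {2}/dird linear_sum /= [RHS]/dird; apply: eq_bigr => i _.
by rewrite linearZ /= dird_mderiv.
Qed.

Lemma lap_mderiv i p : lap p^`M(i) = (lap p)^`M(i).
Proof.
rewrite /lap linear_sum; apply: eq_bigr => j _ /=.
by rewrite (mderiv_comm i) (mderiv_comm i).
Qed.

Lemma dird_lap v p : dird v (lap p) = lap (dird v p).
Proof.
rewrite /dird linear_sum; apply: eq_bigr => j _ /=.
by rewrite linearZ /= lap_mderiv.
Qed.

Lemma dird_iter_lap v k p : dird v (iter k lap p) = iter k lap (dird v p).
Proof. by elim: k => //= k <-; rewrite dird_lap. Qed.

Lemma iter_lap_is_linear k : linear (iter k lap).
Proof. by elim: k => [|k IH] c p q //=; rewrite IH linearP. Qed.
HB.instance Definition _ k := GRing.isLinear.Build R {mpoly R[n]} {mpoly R[n]}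
  _ (iter k lap) (iter_lap_is_linear k).

Lemma mderivXU i j : ('X_j : {mpoly R[n]})^`M(i) = (i == j)%:R.
Proof.
rewrite mderivX mnm1E eq_sym; case: eqP => [->|_]; last by rewrite scale0r.
rewrite scale1r (_ : (U_(j) - U_(j) = 0)%MM) ?mpolyX0 //.
by apply/mnmP => k; rewrite mnmBE subnn mnm0E.
Qed.

Lemma euler_mderiv c i p : euler c p -> euler (c - 1) p^`M(i).
Proof.
rewrite /euler scalerBl scale1r => e; rewrite -linearZ -e linear_sum /=.
under [in RHS]eq_bigr do rewrite mderivM mderivXU.
rewrite big_split /= sum_delta addrC addrK.
by apply: eq_bigr => j _; rewrite mderiv_comm.
Qed.

Lemma euler_lin c a p q : euler c p -> euler c q -> euler c (a *: p + q).
Proof.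
rewrite /euler => ep eq_; rewrite scalerDr scalerA mulrC -scalerA -ep -eq_.
rewrite scaler_sumr -big_split; apply: eq_bigr => i _ /=.
by rewrite linearP /= mulrDr scalerAr.
Qed.

Lemma euler0 c : euler c 0.
Proof. by rewrite /euler scaler0 big1 // => i _; rewrite linear0 mulr0. Qed.

Lemma eulerZ c a p : euler c p -> euler c (a *: p).
Proof. by move=> e; rewrite -[_ *: _]addr0; apply: euler_lin (euler0 _). Qed.

Lemma eulerD c p q : euler c p -> euler c q -> euler c (p + q).
Proof. by move=> ep eq_; rewrite -[p]scale1r; apply: euler_lin. Qed.

Lemma euler_sum c (I : Type) (s : seq I) (P : pred I) (F : I -> {mpoly R[n]}) :
  (forall i, P i -> euler c (F i)) -> euler c (\sum_(i <- s | P i) F i).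
Proof. by move=> e; elim/big_ind: _ => //; [apply: euler0 | apply: eulerD]. Qed.

Lemma eulerM a b p q : euler a p -> euler b q -> euler (a + b) (p * q).
Proof.
rewrite /euler => ep eq_; rewrite scalerDl scalerAl -ep scalerAr -eq_.
rewrite mulr_suml mulr_sumr -big_split; apply: eq_bigr => i _ /=.
by rewrite mderivM; ring.
Qed.

Lemma euler1 : euler 0 1.
Proof. by rewrite /euler scale0r big1 // => i _; rewrite -mpolyC1 mderivC mulr0. Qed.

Lemma eulerX i : euler 1 'X_i.
Proof.
rewrite /euler scale1r -[RHS](sum_delta i (fun j => 'X_j)).
by apply: eq_bigr => j _; rewrite mderivXU mulrC eq_sym.
Qed.

Lemma eulerXn a k p : euler a p -> euler (k%:R * a) (p ^+ k).
Proof.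
move=> e; elim: k => [|k IH]; first by rewrite mul0r expr0; apply: euler1.
by rewrite exprS -addn1 addnC natrD mulrDl mul1r; apply: eulerM.
Qed.

Lemma euler_nrm2 : euler 2 nrm2.
Proof.
by apply: euler_sum => i _; rewrite -[2]mulr1; apply: eulerXn; apply: eulerX.
Qed.

Lemma euler_linform v : euler 1 (linform v).
Proof. by apply: euler_sum => i _; apply/eulerZ/eulerX. Qed.

Lemma euler_dird c v p : euler c p -> euler (c - 1) (dird v p).
Proof. by move=> e; apply: euler_sum => i _; apply/eulerZ/euler_mderiv. Qed.

Lemma euler_lap c p : euler c p -> euler (c - 2) (lap p).
Proof.
move=> e; apply: euler_sum => i _.
by rewrite (_ : c - 2 = c - 1 - 1); [do 2!apply: euler_mderiv | ring].
Qed.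

Lemma euler_iter_lap c k p : euler c p -> euler (c - 2 * k%:R) (iter k lap p).
Proof.
move=> e; elim: k => [|k IH] /=; first by rewrite mulr0 subr0.
rewrite (_ : _ - _ = c - 2 * k%:R - 2); first exact: euler_lap.
by rewrite -addn1 natrD; ring.
Qed.

(** The operator x_i d/dx_i multiplies the coefficient of ['X_[m]] by [m i], so Euler's identity
    compares [mdeg m] and [c] on the support. *)
Lemma euler_coef c p m : euler c p -> p@_m != 0 -> (mdeg m)%:R = c.
Proof.
move=> e pm0; have /(congr1 (mcoeff m)) := e.
rewrite mcoeffZ raddf_sum /= => h; apply: (mulIf pm0); rewrite -h.
under eq_bigr do rewrite mulrC.
rewrite mdegE natr_sum mulr_suml; apply: eq_bigr => i _.
have [mi0|mi0] := posnP (m i).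
  rewrite mi0 mul0r; apply/esym/eqP; rewrite mcoeff_eq0.
  apply: contraL (isT) => /=; rewrite (perm_mem (msuppMX _ _)).
  case/mapP => m' _ mE; move: mi0; rewrite mE mnmDE mnm1E eqxx.
  by [].
have E : (m - U_(i) + U_(i) = m)%MM.
  by rewrite submK //; apply/mnm_lepP => j; rewrite mnm1E; case: eqP => // <-.
rewrite -[in RHS]E addmC mcoeffMX mcoeff_deriv E.
by rewrite mnmBE mnm1E eqxx subn1 prednK // mulr_natl.
Qed.

Lemma euler_meval (d : nat) p c x :
  euler d%:R p -> p.@[fun i => c * x i] = c ^+ d * p.@[x].
Proof.
move=> e; rewrite !mevalE mulr_sumr; apply: eq_big_seq => m.
rewrite mcoeff_msupp => /(euler_coef e)/eqP; rewrite eqr_nat => /eqP <-.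
rewrite mulrCA; congr (_ * _); rewrite mdegE -prodrXr -big_split.
by apply: eq_bigr => i _; rewrite exprMn.
Qed.

Lemma euler_neg c p : euler c p -> c < 0 -> p = 0.
Proof.
move=> e c0; apply/mpolyP => m; rewrite mcoeff0; apply/eqP/negP => /negP pm.
by move: c0; rewrite -(euler_coef e pm) ltNge ler0n.
Qed.

Lemma euler_const p : euler 0 p -> p = (p@_0)%:MP.
Proof.
move=> e; apply/mpolyP => m; rewrite mcoeffC; case: (eqVneq m 0%MM) => [->|m0].
  by rewrite mulr1.
rewrite mulr0; apply/eqP/negP => /negP /(euler_coef e)/eqP.
by rewrite pnatr_eq0 mdeg_eq0 (negbTE m0).
Qed.

Lemma dhomog_euler d p : p \is d.-homog -> euler d%:R p.
Proof.
move=> /dhomogP h; rewrite [p]mpolyE big_seq; apply: euler_sum => m /h /= <-.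
apply: eulerZ; rewrite mpolyXE_id mdegE natr_sum.
elim/big_rec2: _ => [|i q a _ e]; first exact: euler1.
by apply: eulerM => //; rewrite -[_%:R]mulr1; apply/eulerXn/eulerX.
Qed.

Lemma meval_nrm2 x : nrm2.@[x] = sqnorm x.
Proof. by rewrite raddf_sum; apply: eq_bigr => i _ /=; rewrite rmorphXn /= mevalXU. Qed.

Lemma meval_dird v p x : (dird v p).@[x] = \sum_i v i * (p^`M(i)).@[x].
Proof. by rewrite raddf_sum; apply: eq_bigr => i _; rewrite /= mevalZ. Qed.

Lemma meval_dird_self c p x : euler c p -> (dird x p).@[x] = c * p.@[x].
Proof.
move=> e; rewrite -mevalZ -e meval_dird raddf_sum; apply: eq_bigr => i _ /=.
by rewrite mevalM mevalXU.
Qed.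

End Forms.

(** * Gaussian averages *)

Section GaussianMoments.
Variables (n : nat) (R : realFieldType).
Implicit Types (p q : {mpoly R[n]}) (v x : 'I_n -> R).

Fixpoint gauss_moment (k : nat) : R :=
  match k with 0 => 1 | 1 => 0 | k'.+2 => k'.+1%:R * gauss_moment k' end.

Lemma gauss_momentS k : gauss_moment k.+1 = k%:R * gauss_moment k.-1.
Proof. by case: k => [|k] //=; rewrite mul0r. Qed.

(* The expectation of [p g] for a standard Gaussian vector [g]. *)
Definition gauss_E p := \sum_(m <- msupp p) p@_m * \prod_i gauss_moment (m i).

Lemma gauss_E_widen k p : (msize p <= k)%N ->
  gauss_E p = \sum_(m : 'X_{1..n < k}) p@_m * \prod_i gauss_moment (bmnm m i).
Proof.
move=> le_pk; pose I : subFinType _ := 'X_{1..n < k}.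
rewrite /gauss_E (big_mksub I).
- rewrite big_rmcond //= => j /memN_msupp_eq0 ->; exact: mul0r.
- exact: msupp_uniq.
- by move=> m /msize_mdeg_lt /leq_trans; apply.
Qed.

Lemma gauss_E_is_linear : linear_for *%R gauss_E.
Proof.
move=> c p q; pose_big_enough k.
  rewrite !(@gauss_E_widen k) // mulr_sumr -big_split; apply: eq_bigr => m _ /=.
  by rewrite mcoeffD mcoeffZ mulrDl mulrA.
by close.
Qed.
HB.instance Definition _ := GRing.isLinear.Build R {mpoly R[n]} R _
  gauss_E gauss_E_is_linear.

Lemma gauss_E_X m : gauss_E 'X_[m] = \prod_i gauss_moment (m i).
Proof. by rewrite /gauss_E msuppX big_seq1 mcoeffX eqxx mul1r. Qed.

(** Gaussian integration by parts; on a monomial it is [gauss_momentS] for the exponent of the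
    variable [i]. *)
Lemma gauss_E_stein i p : gauss_E ('X_i * p) = gauss_E p^`M(i).
Proof.
rewrite [p]mpolyE mulr_sumr (raddf_sum (mderiv i)) !linear_sum /=; apply: eq_bigr => m _.
rewrite -scalerAr !linearZ /= -mpolyXD mderivX !linearZ /= !gauss_E_X.
congr (_ * _); rewrite (bigD1 i) //= [in RHS](bigD1 i) //= mnmDE mnmBE mnm1E eqxx.
rewrite add1n subn1 gauss_momentS -mulrA; congr (_ * (_ * _)).
apply: eq_bigr => j /negbTE ji; rewrite mnmDE mnmBE mnm1E eq_sym ji.
by rewrite add0n subn0.
Qed.

(** Integrate by parts one factor of each x_i^2: the derivatives of the other factors add up to [n],
    and those of [p] to [c] by Euler's identity. *)
Lemma gauss_E_nrm2 (c : R) p : euler c p -> gauss_E (nrm2 n R * p) = (n%:R + c) * gauss_E p.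
Proof.
move=> e; rewrite mulr_suml linear_sum /=.
under eq_bigr do rewrite expr2 -mulrA gauss_E_stein mderivM mderivXU eqxx mul1r linearD.
by rewrite big_split /= sumr_const card_ord -linear_sum e linearZ /= mulrDl mulr_natl.
Qed.

Lemma gauss_E_lap (c : R) p : euler c p -> gauss_E (lap p) = c * gauss_E p.
Proof.
move=> e; rewrite -linearZ -e !linear_sum; apply: eq_bigr => i _ /=.
by rewrite gauss_E_stein.
Qed.

Lemma gauss_E_nrm2X (c : R) k p : euler c p ->
  gauss_E (nrm2 n R ^+ k * p) = (\prod_(i < k) (n%:R + c + 2 * i%:R)) * gauss_E p.
Proof.
move=> e; elim: k => [|k IH]; first by rewrite big_ord0 !mul1r.
rewrite exprS -mulrA (@gauss_E_nrm2 (k%:R * 2 + c)).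
  by rewrite IH big_ord_recr /=; ring.
by apply: eulerM => //; apply/eulerXn/euler_nrm2.
Qed.

Lemma mderiv_linformX i b x :
  (linform x ^+ b)^`M(i) = (b%:R * x i) *: linform x ^+ b.-1.
Proof.
elim: b => [|b IH]; first by rewrite mul0r scale0r expr0 -mpolyC1 mderivC.
rewrite exprS mderivM IH.
have -> : (linform x)^`M(i) = (x i)%:MP.
  rewrite /linform linear_sum /=.
  under eq_bigr do rewrite linearZ /= mderivXU.
  rewrite (bigD1 i) //= eqxx big1 ?addr0 ?alg_mpolyC // => j.
  by rewrite eq_sym => /negbTE ->; rewrite scaler0.
rewrite mul_mpolyC -scalerAr; case: b {IH} => [|b] /=.
  by rewrite mul0r scale0r addr0 mul1r.
by rewrite -exprS -scalerDl; congr (_ *: _); rewrite -[b.+2]addn1 natrD; ring.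
Qed.

(** Euler's identity supplies the factor x_i to integrate by parts; the derivative then falls on the
    gradient of [q] or on the power of the linear form. *)
Lemma gauss_E_mul_linform (m : R) b x q : euler m q ->
  m * gauss_E (q * linform x ^+ b) =
  gauss_E (lap q * linform x ^+ b) + b%:R * gauss_E (dird x q * linform x ^+ b.-1).
Proof.
move=> e; rewrite -linearZ /= scalerAl -e mulr_suml linear_sum /=.
under eq_bigr do
  rewrite -mulrA gauss_E_stein mderivM mderiv_linformX -scalerAr linearD linearZ /=.
rewrite big_split /= -linear_sum -mulr_suml; congr (_ + _).
rewrite /dird mulr_suml linear_sum mulr_sumr; apply: eq_bigr => i _ /=.
by rewrite -scalerAl linearZ /= mulrA.
Qed.

Lemma gauss_E_linform_even x r :
  gauss_E (linform x ^+ (2 * r)) = (2 * r)`!%:R / (2 ^+ r * r`!%:R) * sqnorm x ^+ r.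
Proof.
elim: r => [|r IH].
  rewrite muln0 !expr0 fact0 -mpolyX0 gauss_E_X big1 => [|i _]; last by rewrite mnm0E.
  by field.
rewrite mulnS -[(2 + 2 * r)%N]/((2 * r).+2) [linform x ^+ _]exprS {1}/linform.
rewrite mulr_suml linear_sum /=.
under eq_bigr do rewrite -scalerAl linearZ /= gauss_E_stein mderiv_linformX linearZ /= IH mulrA.
rewrite -mulr_suml !factS exprS [sqnorm x ^+ r.+1]exprS.
have -> : \sum_(i < n) x i * ((2 * r).+1%:R * x i) = (2 * r).+1%:R * sqnorm x.
  by rewrite mulr_sumr; apply: eq_bigr => i _; rewrite expr2 mulrCA.
have h0 : r`!%:R != 0 :> R by rewrite pnatr_eq0 -lt0n fact_gt0.
have h1 : r.+1%:R != 0 :> R by rewrite pnatr_eq0.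
have h2 : 2 ^+ r != 0 :> R by rewrite expf_neq0 // pnatr_eq0.
rewrite !natrM (_ : (2 * r).+2%:R = 2 * r.+1%:R); first by field; rewrite nat1r h0 h1 h2.
by rewrite -natrM mulnS.
Qed.

(** The coefficient of |x|^(2 (r + k)) in exp (|x|^2 / 2) times that of lap^k in exp (lap / 2). *)
Definition wick_coef r k : R := (2 ^+ (r + 2 * k) * (r + k)`!%:R * k`!%:R)^-1.

Lemma wick_coefS r k : wick_coef r.+1 k = 2 * k.+1%:R * wick_coef r k.+1.
Proof.
have h0 j : j`!%:R != 0 :> R by rewrite pnatr_eq0 -lt0n fact_gt0.
have h1 : k.+1%:R != 0 :> R by rewrite pnatr_eq0.
have h2 j : 2 ^+ j != 0 :> R by rewrite expf_neq0 // pnatr_eq0.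
rewrite /wick_coef (_ : r + 2 * k.+1 = (r.+1 + 2 * k).+1)%N; last by lia.
rewrite -(addSnnS r k) [k.+1`!]factS natrM [2 ^+ _.+1]exprS.
by field; rewrite h0 h2 nat1r h1 h0.
Qed.

(* The part of degree [m + 2r] in [x] of
   E (q (g) exp <g, x>) = exp (|x|^2 / 2) E (q (g + x)). *)
Lemma gauss_E_wick x m : forall r K q, euler m%:R q -> (m < 2 * K)%N ->
  gauss_E (q * linform x ^+ (m + 2 * r)) =
  (m + 2 * r)`!%:R *
    \sum_(k < K) wick_coef r k * sqnorm x ^+ (r + k) * (iter k (@lap n R) q).@[x].
Proof.
(* Strong induction on the degree: [lap q] has degree m - 2 and goes with r + 1, [dird x q] has
   degree m - 1 and goes with the same r. The bound on [K] ensures that the omitted powers of the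
   Laplacian vanish. *)
elim/ltn_ind: m => m IH r [|K] q e; first by rewrite muln0.
case: m => [|m] in IH e *.
  move=> _; rewrite big_ord_recl big1 => [|k _]; last first.
    rewrite (euler_neg (euler_iter_lap _ e)) ?meval0 ?mulr0 //.
    by rewrite sub0r oppr_lt0 -natrM ltr0n.
  rewrite (euler_const e) mul_mpolyC linearZ /= gauss_E_linform_even mevalC.
  by rewrite addr0 addn0 /wick_coef fact0 !mulr1 muln0 addn0; ring.
move=> mK; apply: (@mulfI _ m.+1%:R); first by rewrite pnatr_eq0.
rewrite gauss_E_mul_linform // addSn /=.
rewrite (IH m _ r K.+1 (dird x q)) //; last first.
  by rewrite -[m%:R](addrK 1) natr1; apply: euler_dird.
have -> : gauss_E (lap q * linform x ^+ (m + 2 * r).+1) = (m + 2 * r).+1`!%:R *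
   \sum_(k < K) wick_coef r.+1 k * sqnorm x ^+ (r.+1 + k) * (iter k (@lap n R) (lap q)).@[x].
  case: m => [|m] in IH e mK *.
    rewrite (euler_neg (euler_lap e)) ?subr_lt0 ?ltr1n // mul0r linear0 big1 ?mulr0 // => k _.
    by rewrite linear0 meval0 mulr0.
  rewrite (_ : (m.+1 + 2 * r).+1 = m + 2 * r.+1)%N; last by lia.
  apply: IH => //; last by lia.
  by rewrite (_ : m%:R = m.+2%:R - 2); [apply: euler_lap | rewrite -addn2 natrD addrK].
rewrite factS natrM [in X in _ + X]mulrA -mulrDr mulrCA; congr (_ * _).
rewrite mulr_sumr.
(* By Euler's identity at [x], the directional derivative contributes the k-th term with weight m +
   1 - 2 k; the Laplacian part, shifted by one and rewritten by [wick_coefS], supplies the missing 2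
   k. *)
under [X in _ + X]eq_bigr do
  rewrite -dird_iter_lap (meval_dird_self _ (euler_iter_lap _ e)).
rewrite big_ord_recl [RHS]big_ord_recl addrCA -big_split; congr (_ + _).
  by rewrite mulr0 subr0 mulrCA.
apply: eq_bigr => k _; rewrite wick_coefS -iterSr addSnnS lift0.
by move: (wick_coef _ _) (sqnorm x ^+ _) (_.@[x]) => a b c /=; ring.
Qed.

End GaussianMoments.

(** * Inverting the Gaussian operator *)

Section WickInverse.
Variables (n : nat) (R : realFieldType).
Implicit Types (p q : {mpoly R[n]}) (v x : 'I_n -> R).

Lemma sum_triangle (M : nat) (F : nat -> nat -> R) :
  \sum_(j < M) \sum_(k < M - j) F j (j + k)%N = \sum_(l < M) \sum_(j < l.+1) F j l.
Proof.
elim: M => [|M IH]; first by rewrite !big_ord0.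
rewrite big_ord_recr [RHS]big_ord_recr /= -IH subSnn big_ord1 addn0.
rewrite [in RHS]big_ord_recr /= addrA -big_split; congr (_ + _).
by apply: eq_bigr => j _; rewrite subSn ?big_ord_recr /= ?subnKC // ltnW.
Qed.

Lemma sum_alt_fact l :
  \sum_(j < l.+1) (-1) ^+ j / (j`!%:R * (l - j)`!%:R) = (l == 0%N)%:R :> R.
Proof.
have h0 j : j`!%:R != 0 :> R by rewrite pnatr_eq0 -lt0n fact_gt0.
transitivity ((1 - 1) ^+ l / l`!%:R : R); last first.
  by rewrite subrr expr0n; case: l => [|l]; rewrite ?mul0r ?divr1.
rewrite exprDn mulr_suml; apply: eq_bigr => j _; rewrite expr1n mul1r.
have jl : (j <= l)%N by rewrite -ltnS.
rewrite -[in RHS]mulr_natr -[in RHS]mulrA; congr (_ * _).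
by rewrite -(bin_fact jl) !natrM; field; rewrite !h0 pnatr_eq0 -lt0n bin_gt0 jl.
Qed.

(** The product is the factor by which |g|^(2 j) multiplies a Gaussian average, see [gauss_E_nrm2X]:
    the other factors, lap^j p and the power of the linear form, have total degree (m - 2 j) + (m +
    2 r). Dividing by it leaves (-1)^j / (2^j j!). *)
Definition inv_coef m r j : R := (-1) ^+ j /
  (2 ^+ j * j`!%:R * \prod_(i < j) (n%:R + 2 * m%:R + 2 * r%:R - 2 * j%:R + 2 * i%:R)).

(* The coefficients solve a triangular system: substituted into [gauss_E_wick],
   they make the coefficient of [lap^l] a multiple of (1 - 1)^l / l!. *)
Definition wick_inv m r p :=
  \sum_(j < m./2.+1) inv_coef m r j *: (nrm2 n R ^+ j * iter j (@lap n R) p).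

Lemma wick_inv_is_linear m r : linear (wick_inv m r).
Proof.
move=> c p q; rewrite /wick_inv scaler_sumr -big_split; apply: eq_bigr => j _ /=.
by rewrite linearP /= mulrDr scalerDr -scalerAr !scalerA mulrC.
Qed.
HB.instance Definition _ m r := GRing.isLinear.Build R {mpoly R[n]} {mpoly R[n]}
  _ (wick_inv m r) (wick_inv_is_linear m r).

Lemma gauss_E_wick_inv m r p x : euler m%:R p -> ~~ odd m ->
  gauss_E (wick_inv m r p * linform x ^+ (m + 2 * r)) =
  (m + 2 * r)`!%:R / (2 ^+ r * r`!%:R) * sqnorm x ^+ r * p.@[x].
Proof.
move=> e m_even; set b := (m + 2 * r)%N.
have h0 j : j`!%:R != 0 :> R by rewrite pnatr_eq0 -lt0n fact_gt0.
have h2 j : 2 ^+ j != 0 :> R by rewrite expf_neq0 // pnatr_eq0.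
have m2 : m = (2 * m./2)%N by rewrite mul2n -[LHS]odd_double_half (negbTE m_even).
pose F j l := (-1) ^+ j / (j`!%:R * (l - j)`!%:R) *
  ((2 ^+ (r + 2 * l) * (r + l)`!%:R)^-1 * sqnorm x ^+ (r + l) *
   (iter l (@lap n R) p).@[x]).
(* Here [j] Laplacians come from [wick_inv] and [k] from [gauss_E_wick]; apart from the alternating
   weight, the term depends on j + k alone. *)
transitivity (b`!%:R * \sum_(j < m./2.+1) \sum_(k < m./2.+1 - j) F j (j + k)%N).
  rewrite mulr_suml linear_sum mulr_sumr; apply: eq_bigr => j _.
  rewrite -scalerAl linearZ /= -[X in gauss_E X]mulrA.
  have jm : (2 * j <= m)%N by have := ltn_ord j; lia.
  have ej : euler (m - 2 * j)%:R (iter j (@lap n R) p).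
    by rewrite natrB // natrM; apply: euler_iter_lap.
  rewrite (gauss_E_nrm2X _ (eulerM ej (eulerXn b (euler_linform x)))).
  have bE : b = (m - 2 * j + 2 * (r + j))%N by rewrite /b; lia.
  rewrite [linform x ^+ b](congr1 (fun b => linform x ^+ b) bE).
  rewrite (gauss_E_wick _ _ (K := m./2.+1 - j) ej); last by have := ltn_ord j; lia.
  rewrite -bE.
  rewrite [LHS]mulrA [X in X * _ = _](_ : _ = (-1) ^+ j / (2 ^+ j * j`!%:R)); last first.
    rewrite /inv_coef; set P1 := \prod_(i < _) _; set P2 := \prod_(i < _) _.
    have <- : P1 = P2.
      apply: eq_bigr => i _; rewrite natrB // /b natrD !natrM; ring.
    have P0 : P1 != 0.
      apply/prodf_neq0 => i _; rewrite -!natrM -!natrD -natrB; last by lia.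
      by rewrite -natrD pnatr_eq0; have := ltn_ord i; lia.
    by field; rewrite P0 h0 h2.
  rewrite mulrCA; congr (_ * _); rewrite mulr_sumr; apply: eq_bigr => k _.
  rewrite -iterD [(k + j)%N]addnC /F /wick_coef addKn -!addnA !mulrA; congr (_ * _ * _).
  rewrite (_ : r + 2 * (j + k) = j + (r + (j + 2 * k)))%N; last by lia.
  rewrite [2 ^+ (j + _)]exprD.
  by field; rewrite !h0 !h2.
rewrite sum_triangle big_ord_recl big_ord1 [X in _ + X]big1 => [|l _]; last first.
  by rewrite /F -mulr_suml sum_alt_fact lift0 mul0r.
rewrite /F /= addr0 fact0 muln0 !addn0.
by field; rewrite h0 h2.
Qed.

End WickInverse.

(** * Positivity of Gaussian averages by random walks *)

Section GaussianPositivity.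
Variable R : archiRcfType.
Implicit Types (f : R -> R) (t : R) (u v : nat -> R).

(** The shift by one keeps the denominators away from zero, and matches the factor [N.+1%:R] of the
    recurrence [walk_momentS]. *)
Definition sq N : R := Num.sqrt N.+1%:R.

Lemma sq_gt0 N : 0 < sq N. Proof. by rewrite sqrtr_gt0 ltr0n. Qed.
Lemma sqr_sq N : sq N ^+ 2 = N.+1%:R. Proof. by rewrite sqr_sqrtr // ler0n. Qed.
Lemma sq_ge1 N : 1 <= sq N.
Proof. by rewrite -sqrtr1 ler_sqrt ?ltr01 // ler1n. Qed.
Lemma sqS N : sq N.+1 <= 2 * sq N.
Proof.
rewrite -(@ler_pXn2r _ 2) ?nnegrE ?mulr_ge0 ?ltW ?sq_gt0 //.
have : 1 <= N.+1%:R :> R by rewrite ler1n.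
by rewrite exprMn !sqr_sq -[N.+2%:R]natr1 expr2; lra.
Qed.

(* Convergence at rate [N ^ (- 1 / 2)], which makes it stable under shifts and
   products without any topology. *)
Definition tends u (l : R) := exists C, forall N, `|u N - l| <= C / sq N.

Lemma tends_cst l : tends (fun=> l) l.
Proof. by exists 0 => N; rewrite subrr normr0 mul0r. Qed.

Lemma tends_ext u v l : u =1 v -> tends u l -> tends v l.
Proof. by move=> e [C h]; exists C => N; rewrite -e. Qed.

Lemma tendsD u v l m : tends u l -> tends v m -> tends (fun N => u N + v N) (l + m).
Proof.
move=> [C hC] [D hD]; exists (C + D) => N.
rewrite opprD addrACA mulrDl; apply: le_trans (ler_normD _ _) _.
exact: lerD.
Qed.

Lemma tendsM u v l m : tends u l -> tends v m -> tends (fun N => u N * v N) (l * m).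
Proof.
move=> [C hC] [D hD]; exists (C * (D + `|m|) + `|l| * D) => N.
have D0 : 0 <= D.
  by have := le_trans (normr_ge0 _) (hD 0%N); rewrite pmulr_lge0 ?invr_gt0 ?sq_gt0.
have hv : `|v N| <= D + `|m|.
  rewrite -[v N](subrK m); apply: le_trans (ler_normD _ _) _; rewrite lerD2r.
  apply: le_trans (hD N) _; rewrite ler_pdivrMr ?sq_gt0 //.
  by rewrite ler_peMr // sq_ge1.
rewrite (_ : u N * v N - l * m = (u N - l) * v N + l * (v N - m)); last by ring.
apply: le_trans (ler_normD _ _) _; rewrite !normrM mulrDl; apply: lerD.
  by rewrite mulrAC; apply: ler_pM.
by rewrite -mulrA ler_wpM2l.
Qed.

Lemma tends_sum (I : Type) (s : seq I) (u : I -> nat -> R) (l : I -> R) :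
  (forall i, tends (u i) (l i)) ->
  tends (fun N => \sum_(i <- s) u i N) (\sum_(i <- s) l i).
Proof.
move=> h; elim: s => [|i s IH].
  by rewrite big_nil; apply: tends_ext (tends_cst 0) => N; rewrite big_nil.
rewrite big_cons; apply: tends_ext (tendsD (h i) IH) => N.
by rewrite big_cons.
Qed.

Lemma tends_prod (I : Type) (s : seq I) (u : I -> nat -> R) (l : I -> R) :
  (forall i, tends (u i) (l i)) ->
  tends (fun N => \prod_(i <- s) u i N) (\prod_(i <- s) l i).
Proof.
move=> h; elim: s => [|i s IH].
  by rewrite big_nil; apply: tends_ext (tends_cst 1) => N; rewrite big_nil.
rewrite big_cons; apply: tends_ext (tendsM (h i) IH) => N.
by rewrite big_cons.
Qed.

Lemma tendsX k u l : tends u l -> tends (fun N => u N ^+ k) (l ^+ k).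
Proof.
move=> h; elim: k => [|k IH]; first exact: tends_cst.
by rewrite exprS; apply: tends_ext (tendsM h IH) => N; rewrite exprS.
Qed.

Lemma tends_shift u l : tends (fun N => u N.+1) l -> tends u l.
Proof.
move=> [C hC]; have C0 : 0 <= C.
  by have := le_trans (normr_ge0 _) (hC 0%N); rewrite pmulr_lge0 ?invr_gt0 ?sq_gt0.
exists (2 * C + `|u 0%N - l|) => -[|N].
  by rewrite /sq sqrtr1 divr1 lerDr mulr_ge0.
apply: le_trans (hC N) _; rewrite ler_pdivrMr ?sq_gt0 // mulrAC ler_pdivlMr ?sq_gt0 //.
apply: (@le_trans _ _ (C * (2 * sq N))); first by rewrite ler_wpM2l // sqS.
by rewrite mulrA [C * 2]mulrC ler_wpM2r ?lerDl // ltW // sq_gt0.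
Qed.

Lemma tends_inv_sq : tends (fun N => (sq N)^-1) 0.
Proof.
by exists 1 => N; rewrite subr0 ger0_norm ?div1r // invr_ge0 ltW // sq_gt0.
Qed.

Lemma tends_ratio : tends (fun N => sq N / sq N.+1) 1.
Proof.
exists 1 => N; set r := sq N / sq N.+1.
have r0 : 0 <= r by rewrite divr_ge0 // ltW // sq_gt0.
have r1 : r <= 1.
  rewrite ler_pdivrMr ?sq_gt0 // mul1r /sq ler_sqrt ?ltr0n //.
  by rewrite ler_nat.
rewrite distrC ger0_norm ?subr_ge0 // div1r.
apply: (@le_trans _ _ (1 - r ^+ 2)).
  by rewrite lerD2l lerN2 expr2 -[leRHS]mulr1 ler_wpM2l.
rewrite expr_div_n !sqr_sq -[X in X - _](@divff _ N.+2%:R) ?pnatr_eq0 // -mulrBl.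
rewrite -natrB // subSnn mul1r lef_pV2 ?posrE ?ltr0n ?sq_gt0 //.
apply: (@le_trans _ _ (sq N ^+ 2)); first by rewrite expr2 ler_peMr ?sq_ge1 // ltW // sq_gt0.
by rewrite sqr_sq ler_nat.
Qed.

(** A negative limit would keep all [sq N] below the constant C / - l, against the Archimedean
    property. *)
Lemma tends_ge0 u l : tends u l -> (forall N, 0 <= u N) -> 0 <= l.
Proof.
move=> [C hC] u0; rewrite leNgt; apply/negP => l0.
have h N : sq N <= C / - l.
  rewrite ler_pdivlMr ?oppr_gt0 // mulrC -ler_pdivlMr ?sq_gt0 //.
  apply: le_trans (hC N); rewrite ger0_norm; first by rewrite lerDr.
  by rewrite subr_ge0 (le_trans (ltW l0)).
have := archi_boundP (sqr_ge0 (C / - l)); set N := Num.bound _ => hN.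
have : N.+1%:R <= (C / - l) ^+ 2.
  rewrite -sqr_sq ler_pXn2r ?nnegrE ?(ltW (sq_gt0 _)) //.
  exact: le_trans (ltW (sq_gt0 N)) (h N).
move=> /le_lt_trans /(_ hN); rewrite ltr_nat; lia.
Qed.

Fixpoint walk N : seq R :=
  if N is N'.+1 then [seq t + 1 | t <- walk N'] ++ [seq t - 1 | t <- walk N'] else [:: 0].

(* Expectation of [f S_N] for a simple random walk [S]. *)
Definition walk_E N f := 2 ^- N * \sum_(t <- walk N) f t.

Lemma walk_ES N f :
  walk_E N.+1 f = 2^-1 * (walk_E N (fun t => f (t + 1)) + walk_E N (fun t => f (t - 1))).
Proof.
rewrite /walk_E /= big_cat !big_map -mulrDr mulrA; congr (_ * _).
by rewrite exprS invfM.
Qed.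

Lemma walk_E_ext N f g : f =1 g -> walk_E N f = walk_E N g.
Proof. by move=> e; rewrite /walk_E; congr (_ * _); apply: eq_bigr => t _. Qed.

Lemma walk_ED N f g :
  walk_E N (fun t => f t + g t) = walk_E N f + walk_E N g.
Proof. by rewrite /walk_E big_split mulrDr. Qed.

Lemma walk_EB N f g :
  walk_E N (fun t => f t - g t) = walk_E N f - walk_E N g.
Proof. by rewrite /walk_E sumrB mulrBr. Qed.

Lemma walk_EZ N (a : R) f : walk_E N (fun t => a * f t) = a * walk_E N f.
Proof. by rewrite /walk_E -mulr_sumr mulrCA. Qed.

Lemma walk_E_sum N (I : Type) (s : seq I) (F : I -> R -> R) :
  walk_E N (fun t => \sum_(i <- s) F i t) = \sum_(i <- s) walk_E N (F i).
Proof. by rewrite /walk_E exchange_big -mulr_sumr. Qed.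

(** A discrete integration by parts: the position is a sum of N + 1 exchangeable signs, and
    averaging one sign e out of e f(S) leaves half a central difference of [f] at a walk of N
    steps. *)
Lemma walk_E_mulX N f : walk_E N.+1 (fun t => t * f t) =
  N.+1%:R * walk_E N (fun t => 2^-1 * (f (t + 1) - f (t - 1))).
Proof.
elim: N f => [|N IH] f.
  by rewrite walk_ES /walk_E /= !big_seq1 !add0r; field.
rewrite walk_ES.
pose U g t := 2^-1 * (g (t + 1) + g (t - 1)) : R.
pose V g t := 2^-1 * (g (t + 1) - g (t - 1)) : R.
have -> : walk_E N.+1 (fun t => (t + 1) * f (t + 1)) =
    walk_E N.+1 (fun t => t * f (t + 1)) + walk_E N.+1 (fun t => f (t + 1)).
  by rewrite -walk_ED; apply: walk_E_ext => t; ring.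
have -> : walk_E N.+1 (fun t => (t - 1) * f (t - 1)) =
    walk_E N.+1 (fun t => t * f (t - 1)) - walk_E N.+1 (fun t => f (t - 1)).
  by rewrite -walk_EB; apply: walk_E_ext => t; ring.
rewrite !IH.
have hV : walk_E N.+1 (V f) =
    2^-1 * (walk_E N.+1 (fun t => f (t + 1)) - walk_E N.+1 (fun t => f (t - 1))).
  by rewrite walk_EZ walk_EB.
have hUV : walk_E N.+1 (V f) = 2^-1 * (walk_E N (V (fun t => f (t + 1))) +
   walk_E N (V (fun t => f (t - 1)))).
  by rewrite walk_ES; congr (_ * (_ + _)); apply: walk_E_ext => t; rewrite /V;
     congr (_ * (f _ - f _)); ring.
rewrite -[N.+2%:R]natr1 mulrDl mul1r {1}hUV {1}hV /V; ring.
Qed.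

Definition walk_moment j N := walk_E N (fun t => t ^+ j).

Lemma walk_momentS j N : walk_moment j.+1 N.+1 =
  N.+1%:R * \sum_(i < j.+1) (odd i)%:R * 'C(j, i)%:R * walk_moment (j - i) N.
Proof.
rewrite /walk_moment (@walk_E_ext _ _ (fun t => t * t ^+ j)) => [|t]; last exact: exprS.
rewrite walk_E_mulX; congr (_ * _).
under [RHS]eq_bigr do rewrite -walk_EZ.
rewrite -walk_E_sum; apply: walk_E_ext => t.
rewrite exprDn exprBn -sumrB mulr_sumr; apply: eq_bigr => i _.
rewrite !expr1n -[X in X - _]mulr_natr -[X in _ - X]mulr_natr -signr_odd.
by case: odd => /=; field.
Qed.

Definition scaled_moment j N := walk_moment j N / sq N ^+ j.

Lemma tends_scaled_moment j : tends (scaled_moment j) (gauss_moment R j).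
Proof.
elim/ltn_ind: j => -[_|j IH].
  apply: tends_ext (tends_cst 1) => N; rewrite /scaled_moment expr0 divr1.
  elim: N => [|N E]; first by rewrite /walk_moment /walk_E /= big_seq1 invr1 mul1r.
  by rewrite /walk_moment walk_ES -[walk_E N _]/(walk_moment 0 N) -E; field.
apply: tends_shift.
(* Of the powers of [sq N], the i-th term keeps the exponent - (i - 1), so only i = 1 survives in
   the limit, with the Gaussian recurrence as result. For i = 0, where [i.-1] is 0, the parity
   factor vanishes. *)
pose F i N := (odd i)%:R * 'C(j, i)%:R * (scaled_moment (j - i) N * (sq N)^-1 ^+ i.-1).
apply: (@tends_ext (fun N => (sq N / sq N.+1) ^+ j.+1 * \sum_(i < j.+1) F i N)).
  move=> N; rewrite /scaled_moment walk_momentS -sqr_sq expr_div_n mulrAC.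
  congr (_ / _); rewrite !mulr_sumr; apply: eq_bigr => i _; rewrite /F /scaled_moment.
  case: i => -[|i] /= ij; first by rewrite !mul0r !mulr0.
  have s0 : sq N != 0 by rewrite gt_eqF // sq_gt0.
  rewrite {1}(_ : j.+1 = 2 + (j - i.+1) + i)%N; last by lia.
  by rewrite !exprD exprVn; field; rewrite !expf_neq0.
rewrite gauss_momentS -[X in tends _ X]mul1r -[X in tends _ (X * _)](expr1n _ j.+1).
apply: tendsM; first exact/tendsX/tends_ratio.
rewrite (_ : _ * _ = \sum_(i < j.+1)
   (odd i)%:R * 'C(j, i)%:R * (gauss_moment R (j - i) * 0 ^+ i.-1)); last first.
  case: j {IH F} => [|j]; first by rewrite big_ord1 !mul0r.
  rewrite !big_ord_recl big1 => [|i _]; first by rewrite lift0 /= bin1 subSS subn0; ring.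
  by rewrite /= exprS !(mul0r, mulr0).
apply: tends_sum => i; apply: tendsM; first exact: tends_cst.
apply: tendsM; last exact/tendsX/tends_inv_sq.
by apply: IH; rewrite ltnS leq_subr.
Qed.

(** Let [n] independent walks run: the average of a monomial over the grid of their rescaled
    endpoints factors into scaled moments, so the averages of [p] are nonnegative and converge to
    [gauss_E p]. *)
Lemma gauss_E_ge0 n (p : {mpoly R[n]}) : (forall x, 0 <= p.@[x]) -> 0 <= gauss_E p.
Proof.
move=> p0.
pose node N (k : {ffun 'I_n -> 'I_(size (walk N))}) (i : 'I_n) :=
  tnth (in_tuple (walk N)) (k i) / sq N.
apply: (@tends_ge0 (fun N => (2 ^- N) ^+ n * \sum_k p.@[@node N k])); last first.
  move=> N; rewrite mulr_ge0 ?sumr_ge0 //.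
  by rewrite exprn_ge0 // invr_ge0 exprn_ge0 // ler0n.
rewrite /gauss_E; apply: (@tends_ext
  (fun N => \sum_(m <- msupp p) p@_m * \prod_i scaled_moment (m i) N)).
  move=> N; rewrite mulr_sumr; under [RHS]eq_bigr do rewrite mevalE mulr_sumr.
  rewrite exchange_big; apply: eq_bigr => m _ /=.
  under [RHS]eq_bigr do rewrite mulrCA.
  rewrite -mulr_sumr; congr (_ * _); rewrite -mulr_sumr.
  rewrite -[X in _ ^+ X](card_ord n) -prodr_const.
  rewrite -(bigA_distr_bigA (fun (i : 'I_n) j =>
     (tnth (in_tuple (walk N)) j / sq N) ^+ m i)) -big_split; apply: eq_bigr => i _.
  rewrite /scaled_moment /walk_moment /walk_E -mulrA mulr_suml; congr (_ * _).
  rewrite [LHS]big_tnth; apply: eq_bigr => j _.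
  by rewrite expr_div_n.
apply: tends_sum => m; apply: tendsM; first exact: tends_cst.
by apply: tends_prod => i; apply: tends_scaled_moment.
Qed.

End GaussianPositivity.

(** * Sums of squares *)

Section PsdSos.
Variables (R : rcfType) (I : eqType).
Implicit Types (s : seq I) (G : I -> I -> R) (z : I -> R).

Definition qform s G z := \sum_(a <- s) \sum_(b <- s) z a * z b * G a b.

Lemma qform_ext s G z z' : {in s, z =1 z'} -> qform s G z = qform s G z'.
Proof.
move=> e; apply: eq_big_seq => a sa; apply: eq_big_seq => b sb.
by rewrite !e.
Qed.

Lemma qform_cons k s G z : (forall a b, G a b = G b a) ->
  qform (k :: s) G z =
  z k ^+ 2 * G k k + 2 * z k * (\sum_(a <- s) z a * G k a) + qform s G z.
Proof.
move=> Gs; rewrite /qform !big_cons.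
under [X in _ + X]eq_bigr do rewrite big_cons.
rewrite big_split /= expr2 -!addrA; congr (_ + _); rewrite addrA; congr (_ + _).
rewrite mulr_sumr -big_split; apply: eq_bigr => a _ /=.
by rewrite [G a k]Gs; ring.
Qed.

Lemma linear_ge0 (l q : R) : (forall t, 0 <= 2 * t * l + q) -> l = 0.
Proof.
move=> h; apply/eqP/negP => /negP l0; have := h (- (q + 1) / (2 * l)).
rewrite (_ : 2 * _ * l = - (q + 1)); last by field.
by rewrite opprD addrAC addNr add0r; lra.
Qed.

(** Elimination of one variable at a time. If its diagonal entry is positive, completing the square
    leaves the Schur complement [G'], again semidefinite; if the entry is zero, the mixed terms [l]
    vanish too, because a nonnegative affine function of t is constant. *)
Lemma psd_sos s G : uniq s -> (forall a b, G a b = G b a) ->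
  (forall z, 0 <= qform s G z) ->
  exists L : seq (I -> R), forall z,
    qform s G z = \sum_(c <- L) (\sum_(a <- s) c a * z a) ^+ 2.
Proof.
elim: s G => [|k s IH] G; first by exists [::] => z; rewrite /qform !big_nil.
rewrite cons_uniq => /andP[ks us] Gs Gpsd.
pose l z := \sum_(a <- s) z a * G k a.
pose upd z t := fun a => if a == k then t else z a.
have updE z t : {in s, upd z t =1 z}.
  by move=> a sa; rewrite /upd; case: eqP => // ak; rewrite ak (negbTE ks) in sa.
have lE z t : l (upd z t) = l z by apply: eq_big_seq => a /updE ->.
have upd_ge0 z t : 0 <= t ^+ 2 * G k k + 2 * t * l z + qform s G z.
  have := Gpsd (upd z t); rewrite qform_cons // -/(l _) lE (qform_ext G (updE z t)).
  by rewrite {1 2}/upd eqxx.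
have [g0|g0] := eqVneq (G k k) 0.
  have l0 z : l z = 0.
    by apply: (@linear_ge0 _ (qform s G z)) => t; have := upd_ge0 z t; rewrite g0 mulr0 add0r.
  have [|L hL] := IH G us Gs.
    by move=> z; have := upd_ge0 z 0; rewrite l0 g0 !mulr0 !add0r.
  exists [seq upd c 0 | c <- L] => z.
  rewrite qform_cons // -/(l z) l0 g0 !mulr0 !add0r hL big_map.
  apply: eq_bigr => c _; rewrite big_cons {1}/upd eqxx mul0r add0r.
  by congr (_ ^+ 2); apply: eq_big_seq => a /updE ->.
have gp : 0 < G k k.
  rewrite lt_neqAle eq_sym g0 /=; have := upd_ge0 (fun=> 0) 1.
  rewrite /l big1 => [|a _]; last by rewrite mul0r.
  rewrite /qform big1 => [|a _]; last by rewrite big1 // => b _; rewrite !mul0r.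
  by rewrite mulr0 !addr0 expr1n mul1r.
pose G' a b := G a b - G k a * G k b / G k k.
have QE z : qform s G z = qform s G' z + l z ^+ 2 / G k k.
  rewrite /qform expr2 /l mulr_suml mulr_suml -big_split; apply: eq_bigr => a _ /=.
  rewrite mulr_sumr mulr_suml -big_split; apply: eq_bigr => b _ /=.
  by rewrite /G'; ring.
have [||L hL] := IH G' us.
- by move=> a b; rewrite /G' Gs [G k a * _]mulrC.
- move=> z; have := upd_ge0 z (- l z / G k k); rewrite QE.
  by rewrite [X in 0 <= X -> _](_ : _ = qform s G' z) //; field.
exists ((fun a => Num.sqrt (G k k) * (if a == k then 1 else G k a / G k k)) ::
        [seq upd c 0 | c <- L]) => z.
rewrite qform_cons // -/(l z) big_cons big_map QE [qform s G' z + _]addrC hL !addrA; congr (_ + _).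
  rewrite big_cons eqxx mulr1.
  have -> : \sum_(a <- s) Num.sqrt (G k k) * (if a == k then 1 else G k a / G k k) * z a
     = Num.sqrt (G k k) * (l z / G k k).
    rewrite mulr_suml mulr_sumr; apply: eq_big_seq => a sa.
    have /negbTE -> : a != k by apply: contraNneq ks => <-.
    by ring.
  rewrite -mulrDr exprMn sqr_sqrtr ?ltW //.
  by field.
apply: eq_bigr => c _; rewrite big_cons {1}/upd eqxx mul0r add0r.
by congr (_ ^+ 2); apply: eq_big_seq => a /updE ->.
Qed.

End PsdSos.

Section BiformSos.
Variables (R : archiRcfType) (n : nat).
Implicit Types (x y : 'I_n -> R).

(** Monomials in [x] are indexed by words, not by exponents. Repetitions do no harm in a Gram
    matrix, and the power of a linear form expands over words without multinomial coefficients. *)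
Definition bimon t (a : 'I_n * {ffun 'I_t -> 'I_n}) x y : R :=
  y a.1 * \prod_k x (a.2 k).

Definition biform_sos t (P : ('I_n -> R) -> ('I_n -> R) -> R) :=
  exists L : seq ('I_n * {ffun 'I_t -> 'I_n} -> R), forall x y,
    P x y = \sum_(c <- L) (\sum_a c a * bimon a x y) ^+ 2.

Lemma psd_biform_sos t (G : 'I_n * {ffun 'I_t -> 'I_n} -> _ -> R) :
  (forall a b, G a b = G b a) ->
  (forall z, 0 <= \sum_a \sum_b z a * z b * G a b) ->
  biform_sos t (fun x y => \sum_a \sum_b bimon a x y * bimon b x y * G a b).
Proof.
move=> Gs Gpsd; have [L hL] := psd_sos (index_enum_uniq _) Gs Gpsd.
by exists L => x y; apply: hL.
Qed.

Lemma biform_sos_ext t P Q : (forall x y, P x y = Q x y) ->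
  biform_sos t P -> biform_sos t Q.
Proof. by move=> e [L h]; exists L => x y; rewrite -e. Qed.

Lemma biform_sosZ t P (k : R) : 0 <= k -> biform_sos t P ->
  biform_sos t (fun x y => k * P x y).
Proof.
move=> k0 [L h]; exists [seq (fun a => Num.sqrt k * c a) | c <- L] => x y.
rewrite h big_map mulr_sumr; apply: eq_bigr => c _.
under [in RHS]eq_bigr do rewrite -mulrA.
by rewrite -mulr_sumr exprMn sqr_sqrtr.
Qed.

(** The Gram matrix is [G]. Its value at [z] is the Gaussian average of the form Psi H in the
    direction (W_1(g), ..., W_n(g)), hence nonnegative. For the vector of bimonomials of (x, y), W_i
    is y_i <g, x>^t with 2 t = m + 2 r, and [gauss_E_wick_inv] turns the average into [C] times the
    target. *)
Lemma wick_inv_sos (H : 'I_n -> 'I_n -> {mpoly R[n]}) m r :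
  (forall i j, H i j = H j i) -> (forall i j, euler m%:R (H i j)) -> ~~ odd m ->
  (forall x y, 0 <= \sum_i \sum_j y i * y j * (wick_inv m r (H i j)).@[x]) ->
  biform_sos (m./2 + r) (fun x y =>
    (\sum_i \sum_j y i * y j * (H i j).@[x]) * sqnorm x ^+ r).
Proof.
move=> Hs He m_even Psi0; set t := (m./2 + r)%N.
pose X (w : {ffun 'I_t -> 'I_n}) : {mpoly R[n]} := \prod_k 'X_(w k).
pose G (a b : 'I_n * {ffun 'I_t -> 'I_n}) :=
  gauss_E (wick_inv m r (H a.1 b.1) * (X a.2 * X b.2)).
pose W (z : 'I_n * {ffun 'I_t -> 'I_n} -> R) i := \sum_w z (i, w) *: X w.
have GE z : \sum_a \sum_b z a * z b * G a b =
    gauss_E (\sum_i \sum_j W z i * W z j * wick_inv m r (H i j)).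
  transitivity (\sum_i \sum_w \sum_j \sum_w' z (i, w) * z (j, w') * G (i, w) (j, w')).
    rewrite [RHS]pair_bigA; apply: eq_bigr => -[i w] _; rewrite [RHS]pair_bigA.
    by apply: eq_bigr => -[j w'] _.
  rewrite linear_sum; apply: eq_bigr => i _.
  rewrite exchange_big linear_sum; apply: eq_bigr => j _ /=.
  rewrite /W mulr_suml mulr_suml linear_sum; apply: eq_bigr => w _ /=.
  rewrite [X in X * wick_inv _ _ _]mulr_sumr mulr_suml linear_sum; apply: eq_bigr => w' _ /=.
  by rewrite -scalerAl -scalerAr scalerA -scalerAl linearZ /= /G /= [wick_inv _ _ _ * _]mulrC.
pose C : R := (m + 2 * r)`!%:R / (2 ^+ r * r`!%:R).
have C0 : 0 < C by rewrite divr_gt0 ?mulr_gt0 ?exprn_gt0 ?ltr0n ?fact_gt0.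
have Zs := @psd_biform_sos t G.
apply: (@biform_sos_ext _ (fun x y => C^-1 *
   \sum_a \sum_b bimon a x y * bimon b x y * G a b)); last first.
  apply: biform_sosZ; first by rewrite invr_ge0 ltW.
  apply: Zs => [a b|z].
    by rewrite /G Hs [X a.2 * _]mulrC.
  rewrite GE; apply: gauss_E_ge0 => x.
  have := Psi0 x (fun i => (W z i).@[x]).
  rewrite [X in 0 <= X -> _](_ : _ =
    (\sum_i \sum_j W z i * W z j * wick_inv m r (H i j)).@[x]) //.
  rewrite [RHS]rmorph_sum; apply: eq_bigr => i _; rewrite [RHS]rmorph_sum.
  apply: eq_bigr => j _ /=.
  by rewrite !mevalM.
move=> x y; rewrite (GE (fun a => bimon a x y)).
have WE i : W (fun a => bimon a x y) i = y i *: linform x ^+ t.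
  rewrite /W -[X in _ ^+ X](card_ord t) -prodr_const /linform.
  rewrite (bigA_distr_bigA (fun _ j => x j *: 'X_j)) scaler_sumr.
  apply: eq_bigr => w _; rewrite /bimon /= -scalerA; congr (_ *: _).
  by rewrite scaler_prod.
apply: (@mulfI _ C); first by rewrite gt_eqF.
rewrite mulVKf ?gt_eqF // mulr_suml mulr_sumr linear_sum; apply: eq_bigr => i _ /=.
rewrite mulr_suml mulr_sumr linear_sum; apply: eq_bigr => j _ /=.
rewrite !WE -scalerAl -scalerAr scalerA -scalerAl linearZ /= -exprD.
rewrite mulrC [X in gauss_E X]mulrC.
have -> : (t + t = m + 2 * r)%N.
  by rewrite /t -[in RHS](odd_double_half m) (negbTE m_even); lia.
by rewrite gauss_E_wick_inv // -/C; ring.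
Qed.

End BiformSos.

(** * A Markov inequality *)

Section Chebyshev.
Variable R : realFieldType.
Implicit Types (S P : {poly R}) (X : nat -> R).

(** The logarithmic derivative at 1 is the sum of the 1 / (1 - a), each at least 1 / 2. *)
Lemma deriv_prod_XsubC_at1 (s : seq R) : (forall a, a \in s -> -1 <= a < 1) ->
  let P := \prod_(a <- s) ('X - a%:P) in
  0 < P.[1] /\ (size s)%:R * P.[1] <= 2 * P^`().[1].
Proof.
elim: s => [|a s IH] h /=.
  by rewrite big_nil hornerC derivC hornerC !mul0r mulr0.
have [|P0 P1] := IH; first by move=> b bs; apply: h; rewrite inE bs orbT.
have /andP[a0 a1] := h a (mem_head _ _).
rewrite big_cons derivM derivXsubC mul1r !hornerE.
set p := (\prod_(_ <- _) _).[1] in P0 P1 *; set q := (\prod_(_ <- _) _)^`().[1] in P1 *.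
split; first by rewrite mulr_gt0 // subr_gt0.
have : (1 - a) * ((size s)%:R * p) <= (1 - a) * (2 * q).
  by rewrite ler_wpM2l // subr_ge0 ltW.
have : 0 <= (1 + a) * p by apply: mulr_ge0; [lra | exact: ltW].
rewrite /= -[(size s).+1%:R]natr1; nra.
Qed.

Section Alternation.
Variables (mu : nat) (X : nat -> R).
Hypotheses (X0 : X 0%N = 1) (Xdec : forall i j, (i < j <= mu)%N -> X j < X i).
Hypothesis Xge : forall j, (j <= mu)%N -> -1 <= X j.

Let L (j : 'I_mu.+1) : {poly R} := \prod_(i < mu.+1 | i != j) ('X - (X i)%:P).

Let X_lt1 j : (0 < j <= mu)%N -> X j < 1.
Proof. by move=> h; rewrite -X0; apply: Xdec. Qed.

Let X_neq (i j : 'I_mu.+1) : i != j -> X i != X j.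
Proof.
move=> ij; have [h|h|h] := ltngtP i j.
- by rewrite gt_eqF // Xdec // h -ltnS ltn_ord.
- by rewrite lt_eqF // Xdec // h -ltnS ltn_ord.
- by move: ij; rewrite -val_eqE /= h eqxx.
Qed.

Let L_neq (i j : 'I_mu.+1) : i != j -> (L j).[X i] = 0.
Proof.
by move=> ij; rewrite /L horner_prod (bigD1 i) //= hornerXsubC subrr mul0r.
Qed.

Let L_sign (j : 'I_mu.+1) : 0 < (-1) ^+ j * (L j).[X j].
Proof.
have -> : (-1) ^+ j = \prod_(i < mu.+1 | i != j) (if (i < j)%N then -1 else 1) :> R.
  rewrite -big_mkcondr /= -[in LHS](card_ord j) -prodr_const.
  rewrite (big_ord_widen mu.+1 (fun=> -1)); last exact: ltnW.
  by apply: eq_bigl => i; rewrite -val_eqE /=; case: ltngtP.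
rewrite horner_prod -big_split; apply: prodr_gt0 => i ij /=.
rewrite hornerXsubC; case: ltngtP => [h|h|/eqP]; last by rewrite val_eqE (negbTE ij).
  by rewrite mulN1r opprB subr_gt0 Xdec // h -ltnS ltn_ord.
by rewrite mul1r subr_gt0 Xdec // h -ltnS ltn_ord.
Qed.

(** For j = 0 this is the bound on the logarithmic derivative; for other j, the node 1 is a root of
    [L j], and the derivative there is a product of nonnegative factors. *)
Let L_functional (j : 'I_mu.+1) : mu%:R * (L j).[1] <= 2 * (L j)^`().[1].
Proof.
have [->|j0] := eqVneq j ord0.
  have [] := @deriv_prod_XsubC_at1 [seq X (val i) | i <- enum (predC1 (ord0 : 'I_mu.+1))].
    move=> a /mapP[i]; rewrite mem_enum => i0 ->.
    have hi : (i <= mu)%N by rewrite -ltnS.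
    by rewrite Xge //= X_lt1 // hi andbT lt0n.
  by rewrite big_map size_map big_enum -cardE cardC1 card_ord.
have ->: L j = ('X - 1%:P) * \prod_(i < mu.+1 | (i != j) && (i != ord0)) ('X - (X i)%:P).
  by rewrite /L (bigD1 ord0) 1?eq_sym //= X0.
rewrite derivM derivXsubC mul1r !hornerE subrr !(mul0r, mulr0, addr0).
rewrite /= mulr0 mul0r mulr_ge0 // horner_prod prodr_ge0 // => i /andP[_ i0].
by rewrite hornerXsubC subr_ge0 ltW // X_lt1 // lt0n i0 -ltnS ltn_ord.
Qed.

Let lagrange_nodes S : (size S <= mu.+1)%N ->
  S = \sum_(j < mu.+1) (S.[X j] / (L j).[X j]) *: L j.
Proof.
move=> sS; apply/eqP; rewrite -subr_eq0; set D := _ - _.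
apply: contraT => D0; have := @max_poly_roots _ D [seq X (val i) | i <- enum 'I_mu.+1] D0.
rewrite size_map size_enum_ord => h.
have sL j : (size (L j) <= mu.+1)%N.
  have -> : L j = \prod_(i <- enum (predC1 j)) ('X - (X (val i))%:P) by rewrite big_enum.
  by rewrite size_prod_XsubC -cardE cardC1 card_ord.
have sD : (size D <= mu.+1)%N.
  apply: leq_trans (size_polyD _ _) _; rewrite geq_max sS size_polyN.
  apply: leq_trans (size_sum _ _ _) _; apply/bigmax_leqP => j _.
  exact: leq_trans (size_scale_leq _ _) (sL j).
have : (mu.+1 < size D)%N.
  apply: h.
    apply/allP => a /mapP[i _ ->]; rewrite /root /D !hornerE horner_sum (bigD1 i) //=.
    rewrite big1 => [|j ji]; last by rewrite hornerZ (@L_neq i j) ?mulr0 // eq_sym.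
    rewrite hornerZ addr0 divfK ?subrr //.
    by have := L_sign i; apply: contraTneq => ->; rewrite mulr0 ltxx.
  rewrite map_inj_uniq ?enum_uniq // => i j e; apply/eqP; apply: contraT => /X_neq.
  by rewrite e eqxx.
by rewrite ltnNge sD.
Qed.

(* The functional [2 S'(1) - mu S(1)] takes, on the Lagrange basis of
   alternating nodes, values of alternating signs. *)
Lemma alternating_ineq S : (size S <= mu.+1)%N ->
  (forall j, (j <= mu)%N -> 0 <= (-1) ^+ j * S.[X j]) ->
  mu%:R * S.[1] <= 2 * S^`().[1].
Proof.
move=> sS h; rewrite (lagrange_nodes sS) linear_sum !horner_sum !mulr_sumr.
apply: ler_sum => j _ /=; rewrite derivZ !hornerZ ![_ * (_ / _ * _)]mulrCA.
apply: ler_wpM2l (L_functional j).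
have := mulr_ge0 (h j _) (ltW (L_sign j)); rewrite -ltnS ltn_ord => /(_ isT).
rewrite mulrACA -expr2 sqrr_sign mul1r => SL.
have L0 : (L j).[X j] != 0 by have := L_sign j; apply: contraTneq => ->; rewrite mulr0 ltxx.
rewrite (_ : _ / _ = S.[X j] * (L j).[X j] * (L j).[X j] ^-1 ^+ 2); last by field.
by rewrite mulr_ge0 ?sqr_ge0.
Qed.

End Alternation.

Fixpoint cheb (k : nat) : {poly R} :=
  match k with
  | 0 => 1 | 1 => 'X | (k'.+1 as k1).+1 => 2%:P * 'X * cheb k1 - cheb k'
  end.

Lemma chebSS k : cheb k.+2 = 2%:P * 'X * cheb k.+1 - cheb k. Proof. by []. Qed.

Lemma size_cheb k : (size (cheb k) <= k.+1)%N.
Proof.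
suff : (size (cheb k) <= k.+1)%N /\ (size (cheb k.+1) <= k.+2)%N by case.
elim: k => [|k [IH1 IH2]]; first by rewrite size_poly1 size_polyX.
split=> //; rewrite chebSS; apply: leq_trans (size_polyD _ _) _.
rewrite geq_max size_polyN; apply/andP; split; last by apply: leq_trans IH1 _; lia.
rewrite mul_polyC -scalerAl; apply: leq_trans (size_scale_leq _ _) _.
by apply: leq_trans (size_polyMleq _ _) _; rewrite size_polyX.
Qed.

Lemma cheb_at1 k : (cheb k).[1] = 1 /\ (cheb k)^`().[1] = k%:R ^+ 2.
Proof.
suff : [/\ (cheb k).[1] = 1, (cheb k)^`().[1] = k%:R ^+ 2, (cheb k.+1).[1] = 1 &
   (cheb k.+1)^`().[1] = k.+1%:R ^+ 2] by case.
elim: k => [|k [A B C D]]; first by rewrite derivC derivX !hornerE; split=> //; ring.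
split=> //; rewrite chebSS ?derivE !hornerE ?A ?B ?C ?D; first by ring.
by rewrite -[k.+2%:R]natr1 -[k.+1%:R]natr1; ring.
Qed.

(** The points cos (j pi / mu), described by the properties that the argument needs, since a general
    ordered field has no cosine. *)
Definition cheb_nodes mu X :=
  [/\ X 0%N = 1, forall i j, (i < j <= mu)%N -> X j < X i,
      forall j, (j <= mu)%N -> -1 <= X j &
      forall j, (j <= mu)%N -> (cheb mu).[X j] = (-1) ^+ j].

(** For e = 1 or -1, the polynomial M T_mu - e S has alternating signs at the nodes, so
    [alternating_ineq] applies to it. The constant is the value of the functional at T_mu, as
    T_mu(1) = 1 and T_mu'(1) = mu^2. *)
Lemma cheb_extremal mu X S M : cheb_nodes mu X -> (size S <= mu.+1)%N ->
  (forall j, (j <= mu)%N -> `|S.[X j]| <= M) ->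
  `|2 * S^`().[1] - mu%:R * S.[1]| <= (2 * mu%:R ^+ 2 - mu%:R) * M.
Proof.
move=> [X0 Xdec Xge XT] sS hM.
have key (e : R) : `|e| = 1 ->
    e * (2 * S^`().[1] - mu%:R * S.[1]) <= (2 * mu%:R ^+ 2 - mu%:R) * M.
  move=> e1; have := @alternating_ineq mu X X0 Xdec Xge (M *: cheb mu - e *: S).
  have [c1 c2] := cheb_at1 mu; rewrite !derivE !hornerE c1 c2.
  set s := S.[1]; set s' := S^`().[1] => h.
  suff : mu%:R * (M * 1 - e * s) <= 2 * (M * mu%:R ^+ 2 - e * s').
    move=> H; rewrite -subr_ge0.
    rewrite (_ : _ - _ = 2 * (M * mu%:R ^+ 2 - e * s') - mu%:R * (M * 1 - e * s)); last by rewrite /=; ring.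
    by rewrite subr_ge0.
  apply: h => [|j jmu].
    apply: leq_trans (size_polyD _ _) _; rewrite geq_max size_polyN.
    by rewrite !(leq_trans (size_scale_leq _ _)) // size_cheb.
  rewrite !hornerE XT // mulrBr mulrCA -expr2 sqrr_sign mulr1 subr_ge0.
  apply: le_trans (ler_norm _) _.
  by rewrite !normrM normr_sign mul1r e1 mul1r hM.
rewrite ler_norml; apply/andP; split.
  by have := key (-1); rewrite normrN1 => /(_ erefl); lra.
by have := key 1; rewrite normr1 => /(_ erefl); lra.
Qed.

End Chebyshev.

(** * The Laplacian bound *)

Section Restriction.
Variables (n : nat) (R : rcfType).
Implicit Types (p : {mpoly R[n]}) (u v x : 'I_n -> R).

Definition line_poly u v p : {poly R} := mmap polyC (fun i => (u i)%:P + v i *: 'X) p.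

Lemma line_poly_is_linear u v : linear (line_poly u v).
Proof. by move=> c p q; rewrite /line_poly mmapD mmapZ mul_polyC. Qed.
HB.instance Definition _ u v := GRing.isLinear.Build R {mpoly R[n]} {poly R}
  _ (line_poly u v) (line_poly_is_linear u v).

Lemma horner_line_poly u v p s : (line_poly u v p).[s] = p.@[fun i => u i + s * v i].
Proof.
rewrite [p]mpolyE linear_sum /= horner_sum raddf_sum; apply: eq_bigr => m _ /=.
rewrite linearZ /= hornerZ mevalZ /line_poly mmapX mevalX horner_prod; congr (_ * _).
by apply: eq_bigr => i _; rewrite horner_exp !hornerE mulrC.
Qed.

Lemma deriv_line_poly u v p : (line_poly u v p)^`() = line_poly u v (dird v p).
Proof.
pose D q := (line_poly u v q)^`() = line_poly u v (dird v q).
have DM q r : D q -> D r -> D (q * r).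
  rewrite /D => Dq Dr; rewrite /line_poly rmorphM derivM -/(line_poly _ _ _) Dq.
  rewrite -/(line_poly _ _ _) Dr -!rmorphM -rmorphD; congr (mmap _ _ _).
  rewrite /dird mulr_suml mulr_sumr -big_split; apply: eq_bigr => i _ /=.
  by rewrite mderivM scalerDr scalerAl scalerAr.
have D1 : D 1.
  rewrite /D /line_poly rmorph1 derivC /dird big1 ?rmorph0 // => i _.
  by rewrite -mpolyC1 mderivC scaler0.
have DX i : D 'X_i.
  rewrite /D /line_poly mmapX mmap1U derivD derivC derivZ derivX add0r.
  have -> : dird v 'X_i = (v i)%:MP.
    rewrite /dird (bigD1 i) //= mderivXU eqxx big1 ?addr0 ?alg_mpolyC // => j ji.
    by rewrite mderivXU (negbTE ji) scaler0.
  by rewrite mmapC alg_polyC.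
suff : D p by [].
rewrite [p]mpolyE /D (linear_sum (dird v)) !(linear_sum (line_poly u v)) linear_sum /=.
apply: eq_bigr => m _.
rewrite !linearZ /=; congr (_ *: _); rewrite mpolyXE_id.
apply: (big_ind D) => // i _; elim: (m i) => [|k IH]; first exact: D1.
by rewrite exprS; apply: DM.
Qed.

(** [G] is the dehomogenization of a binary form [phi] of degree [m]. Phrased through values, the
    relation passes to products and combinations; the line c = 0, where s / c is meaningless, sees
    only the coefficient of degree [m]. *)
Definition plane_form (m : nat) (G : {poly R}) (phi : R -> R -> R) :=
  [/\ (size G <= m.+1)%N, forall c s, c != 0 -> phi c s = c ^+ m * G.[s / c] &
      forall s, phi 0 s = G`_m * s ^+ m].

Lemma plane_formM a b G H phi psi : plane_form a G phi -> plane_form b H psi ->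
  plane_form (a + b) (G * H) (fun c s => phi c s * psi c s).
Proof.
move=> [sG hG G0] [sH hH H0]; split.
- apply: leq_trans (size_polyMleq _ _) _; lia.
- by move=> c s c0; rewrite hG // hH // hornerM exprD; ring.
move=> s; rewrite G0 H0 coefM.
have ab : (a < (a + b).+1)%N by lia.
rewrite (bigD1 (Ordinal ab)) //= addKn big1 ?addr0; first by rewrite exprD; ring.
case=> i /= ilt; rewrite -val_eqE /= => ia.
have [h|h|h] := ltngtP i a; last by rewrite h eqxx in ia.
  rewrite [X in _ * X]nth_default ?mulr0 //; apply: leq_trans sH _; clear -h; lia.
by rewrite nth_default ?mul0r //; exact: leq_trans sG h.
Qed.

Lemma plane_form_lin k m G H phi psi : plane_form m G phi -> plane_form m H psi ->
  plane_form m (k *: G + H) (fun c s => k * phi c s + psi c s).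
Proof.
move=> [sG hG G0] [sH hH H0]; split.
- apply: leq_trans (size_polyD _ _) _; rewrite geq_max sH andbT.
  exact: leq_trans (size_scale_leq _ _) sG.
- by move=> c s c0; rewrite hG // hH // !hornerE /=; ring.
by move=> s; rewrite G0 H0 coefD coefZ; ring.
Qed.

Lemma plane_form_ext m G H phi psi : G = H -> (forall c s, phi c s = psi c s) ->
  plane_form m G phi -> plane_form m H psi.
Proof.
move=> <- e [h1 h2 h3]; split=> // [c s c0|s]; rewrite -e; [exact: h2 | exact: h3].
Qed.

Lemma plane_form_euler (m : nat) u v p : euler m%:R p ->
  plane_form m (line_poly u v p) (fun c s => p.@[fun i => c * u i + s * v i]).
Proof.
move=> e.
have F0 : plane_form m 0 (fun _ _ => 0).
  by split=> [|c s _|s]; rewrite ?size_poly0 // ?horner0 ?mulr0 ?coef0 ?mul0r.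
have F1 : plane_form 0 1 (fun _ _ => 1).
  by split=> [|c s _|s]; rewrite ?size_poly1 // ?hornerE ?coef1 ?mulr1.
have FX i : plane_form 1 ((u i)%:P + v i *: 'X) (fun c s => c * u i + s * v i).
  split=> [|c s c0|s]; rewrite ?hornerE.
  - apply: leq_trans (size_polyD _ _) _; rewrite geq_max size_polyC.
    by rewrite (leq_trans (size_scale_leq _ _)) ?size_polyX // andbT; case: eqP.
  - by rewrite expr1 /=; field.
  - by rewrite coefD coefC coefZ coefX /=; ring.
have FM (k : 'X_{1..n}) : plane_form (mdeg k) (line_poly u v 'X_[k])
    (fun c s => \prod_i (c * u i + s * v i) ^+ k i).
  rewrite /line_poly mmapX /mmap1 mdegE.
  elim: (index_enum _) => [|i s IH].
    by rewrite !big_nil; apply: plane_form_ext F1 => // c s; rewrite big_nil.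
  rewrite !big_cons; apply: (@plane_form_ext _ _ _ (fun c t =>
     (c * u i + t * v i) ^+ k i * \prod_(i <- s) (c * u i + t * v i) ^+ k i) _ erefl).
    by move=> c t; rewrite big_cons.
  apply: plane_formM IH; elim: (k i) => [|j IHj]; first exact: F1.
  rewrite exprS; apply: plane_form_ext (plane_formM (FX i) IHj) => // c t.
  by rewrite exprS.
have hs : forall k, k \in msupp p -> mdeg k = m.
  by move=> k; rewrite mcoeff_msupp => /(euler_coef e)/eqP; rewrite eqr_nat => /eqP.
apply: (@plane_form_ext _ (\sum_(k <- msupp p) p@_k *: line_poly u v 'X_[k]) _
  (fun c s => \sum_(k <- msupp p) p@_k * \prod_i (c * u i + s * v i) ^+ k i)).
- by rewrite [in RHS](mpolyE p) linear_sum; apply: eq_bigr => k _; rewrite /= linearZ.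
- by move=> c s; rewrite mevalE.
elim: (msupp p) hs => [|k s IH] hs.
  by apply: plane_form_ext F0; rewrite ?big_nil // => c s; rewrite big_nil.
have FMk := FM k; rewrite (hs k (mem_head _ _)) in FMk.
rewrite big_cons; apply: plane_form_ext (plane_form_lin p@_k FMk (IH _)) => // [c t|].
  by rewrite big_cons.
by move=> j js; apply: hs; rewrite inE js orbT.
Qed.

Lemma plane_formE m G phi c s : plane_form m G phi ->
  phi c s = \sum_(l < m.+1) G`_l * c ^+ (m - l) * s ^+ l.
Proof.
move=> [sG hG G0]; have [->|c0] := eqVneq c 0.
  rewrite G0 big_ord_recr /= subnn expr0 mulr1 big1 ?add0r // => i _.
  by rewrite expr0n subn_eq0 leqNgt ltn_ord mulr0 mul0r.
rewrite hG // (horner_coef_wide _ sG) mulr_sumr; apply: eq_bigr => l _.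
have lm : (l <= m)%N by rewrite -ltnS.
by rewrite expr_div_n -{1}(subnK lm) exprD; field; rewrite expf_neq0.
Qed.

End Restriction.

Section LaplacianBound.
Variables (n : nat) (R : rcfType).
Implicit Types (p : {mpoly R[n]}) (u v x : 'I_n -> R).

Lemma sum_even (F : nat -> R) mu :
  \sum_(l < (2 * mu).+1) (~~ odd l)%:R * F l = \sum_(l < mu.+1) F (2 * l)%N.
Proof.
elim: mu => [|mu IH]; first by rewrite muln0 !big_ord1 mul1r muln0.
rewrite mulnS 2!big_ord_recr [RHS]big_ord_recr /= -IH.
by rewrite !oddM /= mul1r mul0r addr0 mulnS.
Qed.

Lemma sqnorm_comb c s u v : sqnorm u = 1 -> sqnorm v = 1 -> dot u v = 0 ->
  sqnorm (fun i => c * u i + s * v i) = c ^+ 2 + s ^+ 2.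
Proof.
move=> u1 v1 uv; rewrite /sqnorm.
under eq_bigr do rewrite sqrrD !exprMn.
rewrite !big_split /= -!mulr_sumr -/(sqnorm u) -/(sqnorm v) u1 v1 !mulr1.
rewrite [X in _ + X + _](_ : _ = 2 * c * s * dot u v); first by rewrite uv mulr0 addr0.
by rewrite [RHS]mulr_sumr -big_split; apply: eq_bigr => i _ /=; ring.
Qed.

(** On the circle c u + s v, averaging over v and -v leaves the even powers of s, that is, a
    polynomial [S] of degree at most [mu] in t = c^2 - s^2; [A] and [B] are c^2 and s^2 in terms of
    t. If g_l are the coefficients of p(u + X v), then 2 S'(1) - mu S(1) = - g_2, and the second
    derivative is 2 g_2. *)
Lemma second_dir_bound (X : nat -> R) mu p u v (M : R) : (0 < mu)%N -> cheb_nodes mu X ->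
  euler (2 * mu)%:R p -> (forall x, sqnorm x = 1 -> `|p.@[x]| <= M) ->
  sqnorm u = 1 -> sqnorm v = 1 -> dot u v = 0 ->
  `|(dird v (dird v p)).@[u]| <= (2 * mu)%:R * ((2 * mu)%:R - 1) * M.
Proof.
move=> mu0 nodes e hM u1 v1 uv.
pose g l := (line_poly u v p)`_l.
have pE c s := @plane_formE _ _ _ _ c s (plane_form_euler u v e).
have g0 : g 0%N = p.@[u].
  rewrite /g -horner_coef0 horner_line_poly; apply: meval_eq => i.
  by rewrite mul0r addr0.
have g2 : (dird v (dird v p)).@[u] = 2 * g 2%N.
  rewrite (_ : _.@[u] = ((line_poly u v p)^`()^`()).[0]).
    by rewrite horner_coef0 !coef_deriv -/(g 2%N) mulr1n mulr_natl.
  rewrite !deriv_line_poly horner_line_poly; apply: meval_eq => i.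
  by rewrite mul0r addr0.
pose A : {poly R} := 2^-1 *: (1 + 'X); pose B : {poly R} := 2^-1 *: (1 - 'X).
pose S := \sum_(l < mu.+1) g (2 * l)%N *: (A ^+ (mu - l) * B ^+ l).
have A1 : A.[1] = 1 by rewrite !hornerE; field.
have B1 : B.[1] = 0 by rewrite !hornerE subrr mulr0.
have sS : (size S <= mu.+1)%N.
  apply: leq_trans (size_sum _ _ _) _; apply/bigmax_leqP => l _.
  apply: leq_trans (size_scale_leq _ _) _.
  have s2 (P : {poly R}) k : (size P <= 2)%N -> (size (P ^+ k) <= k.+1)%N.
    move=> sP; apply: leq_trans (size_poly_exp_leq _ _) _.
    by rewrite ltnS -[leqRHS]mul1n leq_mul2r; apply/orP; right; case: size sP => [|[|[]]].
  have sA : (size A <= 2)%N.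
    apply: leq_trans (size_scale_leq _ _) _; apply: leq_trans (size_polyD _ _) _.
    by rewrite geq_max size_poly1 size_polyX.
  have sB : (size B <= 2)%N.
    apply: leq_trans (size_scale_leq _ _) _; apply: leq_trans (size_polyD _ _) _.
    by rewrite geq_max size_polyN size_poly1 size_polyX.
  apply: leq_trans (size_polyMleq _ _) _.
  have := s2 A (mu - l)%N sA; have := s2 B l sB; have := ltn_ord l.
  move: (size (A ^+ _)) (size (B ^+ _)) => a b; case: l => l /= _; clear; lia.
have S1 : S.[1] = g 0%N.
  rewrite /S horner_sum big_ord_recl big1 => [|l _].
    by rewrite hornerZ hornerM !horner_exp A1 expr0 expr1n !mulr1 addr0 muln0.
  by rewrite hornerZ hornerM !horner_exp B1 lift0 exprS mul0r !mulr0.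
have dA : A^`() = (2^-1)%:P by rewrite /A !derivE add0r alg_polyC.
have dB : B^`() = (- 2^-1)%:P by rewrite /B !derivE sub0r scalerN alg_polyC polyCN.
have S1' : S^`().[1] = mu%:R / 2 * g 0%N - 2^-1 * g 2%N.
  rewrite /S linear_sum horner_sum /=.
  have term l : ((g (2 * l)%N *: (A ^+ (mu - l) * B ^+ l))^`()).[1] =
      g (2 * l)%N * ((mu - l)%:R / 2 * (l == 0%N)%:R - 2^-1 * (l == 1%N)%:R).
    rewrite derivZ hornerZ derivM hornerD !hornerM !horner_exp A1 B1 !expr1n !mul1r.
    rewrite !deriv_exp !hornerMn !hornerM !horner_exp A1 B1 dA dB !hornerC expr1n.
    congr (_ * _); case: l => [|[|l]] /=.
    - by rewrite expr0 -[2^-1 * 1 *+ _]mulr_natl; ring.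
    - by rewrite expr1 expr0 mulr1n; ring.
    - by rewrite !exprS -mulr_natr -[X in _ + X]mulr_natr; ring.
  under eq_bigr do rewrite term.
  have [k muk] : exists k, mu = k.+1 by exists mu.-1; rewrite prednK.
  rewrite muk big_ord_recl big_ord_recl big1 => [|l _]; last by rewrite !lift0 /=; ring.
  by rewrite !lift0 /= muln0 subn0 muln1; ring.
have SX t : -1 <= t <= 1 -> `|S.[t]| <= M.
  move=> /andP[t0 t1].
  pose c := Num.sqrt (2^-1 * (1 + t)); pose s := Num.sqrt (2^-1 * (1 - t)).
  have c2 : c ^+ 2 = A.[t] by rewrite sqr_sqrtr ?hornerE //; lra.
  have s2 : s ^+ 2 = B.[t] by rewrite sqr_sqrtr ?hornerE //; lra.
  have cs : c ^+ 2 + s ^+ 2 = 1 by rewrite c2 s2 !hornerE /=; field.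
  have -> : S.[t] = 2^-1 * (p.@[fun i => c * u i + s * v i] +
                          p.@[fun i => c * u i + (- s) * v i]).
    rewrite !pE -big_split mulr_sumr /=.
    transitivity (\sum_(l < (2 * mu).+1) (~~ odd l)%:R * (g l * c ^+ (2 * mu - l) * s ^+ l)).
      rewrite (sum_even (fun l => g l * c ^+ (2 * mu - l) * s ^+ l)) horner_sum.
      apply: eq_bigr => l _; rewrite hornerZ hornerM !horner_exp -c2 -s2 -!exprM mulrA.
      by rewrite mulnBr.
    apply: eq_bigr => l _; rewrite -/(g l) [(- s) ^+ l]exprNn -signr_odd.
    by case: odd => /=; field.
  have M1 : `|p.@[fun i => c * u i + s * v i]| <= M.
    by apply: hM; rewrite sqnorm_comb.
  have M2 : `|p.@[fun i => c * u i + (- s) * v i]| <= M.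
    by apply: hM; rewrite sqnorm_comb // sqrrN.
  rewrite normrM gtr0_norm ?invr_gt0 ?ltr0n //.
  have := ler_normD p.@[fun i => c * u i + s * v i] p.@[fun i => c * u i + (- s) * v i].
  by move: M1 M2; lra.
have nodes01 j : (j <= mu)%N -> -1 <= X j <= 1.
  move=> jmu; have [X0 Xdec Xge _] := nodes; rewrite Xge //=.
  by case: j jmu => [|j] jmu; rewrite ?X0 // -X0 ltW // Xdec.
have := cheb_extremal nodes sS (fun j jmu => SX _ (nodes01 j jmu)).
rewrite S1 S1' g2 natrM.
rewrite (_ : 2 * _ - _ = - g 2%N) ?normrN; last by field.
by rewrite normrM gtr0_norm ?ltr0n // => h; rewrite -(ler_pM2l (ltr0n _ 2)) in h; nra.
Qed.

(* [o] is the reflection that exchanges [u] and a basis vector. *)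
Lemma orthobasis u (i0 : 'I_n) : sqnorm u = 1 ->
  exists o : 'I_n -> 'I_n -> R,
    [/\ o i0 =1 u, forall a b, \sum_i o i a * o i b = (a == b)%:R &
        forall i j, dot (o i) (o j) = (i == j)%:R].
Proof.
move=> u1; pose e a : R := (i0 == a)%:R; pose w a := u a - e a.
pose q := sqnorm w.
have qE : q = - 2 * w i0.
  rewrite /q /sqnorm (eq_bigr (fun a => u a ^+ 2 + e a * (1 - 2 * u a))) => [|a _].
    by rewrite big_split /= -/(sqnorm u) u1 sum_delta /w /e eqxx /=; ring.
  by rewrite /w /e; case: (i0 == a) => /=; ring.
have [q0|q0] := eqVneq q 0.
  have w0 a : w a = 0.
    apply/eqP; rewrite -sqrf_eq0; move/eqP: q0; rewrite psumr_eq0 => [|i _]; last exact: sqr_ge0.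
    by move/allP/(_ a (mem_index_enum a)).
  exists (fun i a => (i == a)%:R); split=> [a|a b|i j].
  - by have := w0 a; rewrite /w /e => /eqP; rewrite subr_eq0 => /eqP ->.
  - under eq_bigr do rewrite [_ == a]eq_sym.
    by rewrite sum_delta eq_sym.
  - by rewrite /dot sum_delta eq_sym.
pose o i a := (i == a)%:R - 2 * w i * w a / q.
have osym i a : o i a = o a i by rewrite /o eq_sym; ring.
have orth a b : \sum_i o i a * o i b = (a == b)%:R.
  rewrite (eq_bigr (fun i => (a == i)%:R * (i == b)%:R - (2 / q * w b) * ((a == i)%:R * w i)
     - (2 / q * w a) * ((b == i)%:R * w i) + (4 * w a * w b / q ^+ 2) * w i ^+ 2)); last first.
    by move=> i _; rewrite /o [i == a]eq_sym [i == b]eq_sym; field.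
  rewrite big_split !sumrB /= -!mulr_sumr !sum_delta -/(sqnorm w) -/q.
  by field.
exists o; split=> // [a|i j].
  rewrite /o -/(e a) -[RHS](subrK (e a)) -/(w a) addrC; congr (_ + _).
  by rewrite qE in q0 *; field; move: q0; rewrite mulf_eq0 negb_or => /andP[].
by rewrite -orth; apply: eq_bigr => a _; rewrite osym [o j a]osym.
Qed.

Lemma lap_orthobasis (o : 'I_n -> 'I_n -> R) p :
  (forall a b, \sum_i o i a * o i b = (a == b)%:R) ->
  lap p = \sum_i dird (o i) (dird (o i) p).
Proof.
move=> orth; rewrite /dird.
under eq_bigr do under eq_bigr do rewrite (linear_sum (mderiv _)) scaler_sumr.
rewrite exchange_big; apply: eq_bigr => a _ /=.
rewrite exchange_big (bigD1 a) //= [X in _ + X]big1 ?addr0 => [|b ba].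
  under eq_bigr do rewrite linearZ /= scalerA.
  by rewrite -scaler_suml orth eqxx scale1r.
under eq_bigr do rewrite linearZ /= scalerA.
by rewrite -scaler_suml orth eq_sym (negbTE ba) scale0r.
Qed.

Lemma dird2_self (m : R) p u : euler m p ->
  (dird u (dird u p)).@[u] = m * (m - 1) * p.@[u].
Proof.
move=> e; rewrite (meval_dird_self _ (euler_dird u e)) (meval_dird_self _ e).
by rewrite mulrA [(m - 1) * _]mulrC.
Qed.

(** In an orthonormal basis that contains [u], the direction [u] contributes m (m - 1) p(u) by
    Euler's identity, with m = 2 mu, and each orthogonal direction obeys the same bound by
    [second_dir_bound]. *)
Lemma lap_bound (X : nat -> R) mu p (M : R) : cheb_nodes mu X ->
  euler (2 * mu)%:R p -> (forall x, sqnorm x = 1 -> `|p.@[x]| <= M) ->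
  forall u, sqnorm u = 1 ->
  `|(lap p).@[u]| <= n%:R * ((2 * mu)%:R * ((2 * mu)%:R - 1)) * M.
Proof.
move=> nodes e hM u u1; have [mu0|mu0] := posnP mu.
  rewrite mu0 muln0 in e *; rewrite (euler_neg (euler_lap e)) ?meval0 ?normr0; last first.
    by rewrite sub0r oppr_lt0 ltr0n.
  by rewrite mul0r mulr0 mul0r.
have [i0|nI] := pickP 'I_n; last first.
  by move: u1 => /eqP; rewrite /sqnorm big1 1?eq_sym ?oner_eq0 // => i; have := nI i.
move=> _; have [o [o0 orth on]] := orthobasis i0 u1.
rewrite (lap_orthobasis p orth) raddf_sum; apply: le_trans (ler_norm_sum _ _ _) _.
rewrite -mulrA mulr_natl -[X in _ *+ X](card_ord n) -sumr_const.
apply: ler_sum => i _ /=.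
have sq1 j : sqnorm (o j) = 1.
  by rewrite -[RHS]/(true%:R) -(eqxx j) -on; apply: eq_bigr => a _; rewrite expr2.
have ou : forall q, dird (o i0) q = dird u q.
  by move=> q; apply: eq_bigr => a _; rewrite o0.
have [->|ii0] := eqVneq i i0.
  rewrite !ou (dird2_self u e) normrM; apply: ler_pM => //; last exact: hM.
  rewrite ger0_norm // mulr_ge0 // subr_ge0 ler1n; lia.
apply: (second_dir_bound mu0 nodes e hM u1 (sq1 i)).
rewrite -[RHS]/(false%:R) -(negbTE ii0) eq_sym -on.
by apply: eq_bigr => a _; rewrite o0.
Qed.

End LaplacianBound.

(** * Nonnegativity of [wick_inv] from the Laplacian bound *)

Section WickInverseBound.
Variables (n : nat) (R : archiRcfType).
Implicit Types (p : {mpoly R[n]}) (u v x : 'I_n -> R).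

Lemma unit_vec : (0 < n)%N -> exists u, sqnorm u = 1.
Proof.
move=> n0; exists (fun i => (Ordinal n0 == i)%:R).
rewrite /sqnorm -[RHS](sum_delta (Ordinal n0) (fun=> 1)); apply: eq_bigr => i _.
by case: eqP => _; rewrite ?expr1n ?mul1r // expr0n mul0r.
Qed.

Lemma polar x : (0 < n)%N ->
  exists c u, [/\ 0 <= c, sqnorm u = 1 & x =1 fun i => c * u i].
Proof.
move=> n0; have x0 : 0 <= sqnorm x by apply: sumr_ge0 => i _; apply: sqr_ge0.
have [z|nz] := eqVneq (sqnorm x) 0.
  have [u u1] := unit_vec n0; exists 0, u; split=> // i; rewrite mul0r; apply/eqP.
  rewrite -sqrf_eq0; move/eqP: z; rewrite psumr_eq0 => [|j _]; last exact: sqr_ge0.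
  by move/allP/(_ i (mem_index_enum i)).
exists (Num.sqrt (sqnorm x)), (fun i => x i / Num.sqrt (sqnorm x)).
have s0 : Num.sqrt (sqnorm x) != 0 by rewrite sqrtr_eq0 -ltNge lt_neqAle eq_sym nz.
split=> [||i]; rewrite ?sqrtr_ge0 //; last by rewrite mulrC divfK.
rewrite /sqnorm; under eq_bigr do rewrite expr_div_n.
by rewrite -mulr_suml sqr_sqrtr // divff.
Qed.

Lemma euler_ge0 m p : (0 < n)%N -> euler m%:R p ->
  (forall u, sqnorm u = 1 -> 0 <= p.@[u]) -> forall x, 0 <= p.@[x].
Proof.
move=> n0 e h x; have [c [u [c0 u1 xE]]] := polar x n0.
by rewrite (meval_eq _ xE) (euler_meval _ _ e) mulr_ge0 ?exprn_ge0 ?h.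
Qed.

Lemma euler_wick_inv m r p : euler m%:R p -> euler m%:R (wick_inv m r p).
Proof.
move=> e; apply: euler_sum => j _; apply: eulerZ.
rewrite (_ : m%:R = j%:R * 2 + (m%:R - 2 * j%:R)); last by ring.
by apply: eulerM; [apply/eulerXn/euler_nrm2 | apply: euler_iter_lap].
Qed.

Definition ff2 (m : nat) := (m * m.-1)%N.

Lemma natr_ff2 k : (ff2 k)%:R = k%:R * (k%:R - 1) :> R.
Proof.
rewrite /ff2 natrM; case: k => [|k]; first by rewrite !mul0r.
by rewrite -[X in X - 1]natr1 addrK.
Qed.

Lemma iter_lap_bound p m (M : R) :
  (forall mu, exists X : nat -> R, cheb_nodes mu X) ->
  ~~ odd m -> euler m%:R p -> (forall x, sqnorm x = 1 -> `|p.@[x]| <= M) ->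
  forall j u, (j <= m./2)%N -> sqnorm u = 1 ->
  `|(iter j (@lap n R) p).@[u]| <= (\prod_(i < j) (n * ff2 (m - 2 * i))%:R) * M.
Proof.
move=> nodes m_even e hM; elim=> [|j IH] u jm u1; first by rewrite big_ord0 mul1r hM.
have mE : m = (2 * m./2)%N by rewrite mul2n -[LHS]odd_double_half (negbTE m_even).
have mj : (m - 2 * j = 2 * (m./2 - j))%N by rewrite mulnBr -mE.
have [X hX] := nodes (m./2 - j)%N.
have ej : euler (2 * (m./2 - j))%:R (iter j (@lap n R) p).
  by rewrite -mj natrB ?natrM; [apply: euler_iter_lap | rewrite mE leq_mul2l ltnW].
have hj x (x1 : sqnorm x = 1) := IH x (ltnW jm) x1.
have := lap_bound hX ej hj u1.
rewrite iterS big_ord_recr /= -mj => h; apply: le_trans h _.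
rewrite le_eqVlt; apply/orP; left; apply/eqP.
by rewrite natrM natr_ff2; ring.
Qed.

(** Put D = n + m + 2 r. Since 2 j <= m, each factor in the denominator of [inv_coef] is at least D,
    so on the sphere the j-th correction to [p] is at most M t_j. From t_1 on, the t_j decrease at
    least geometrically with ratio rho, and the last hypothesis is M t_1 <= lo (1 - rho) multiplied
    by 4 D. *)
Lemma wick_inv_ge0 p m r (lo M : R) :
  (forall mu, exists X : nat -> R, cheb_nodes mu X) ->
  ~~ odd m -> (0 < m)%N -> (0 < n)%N -> euler m%:R p -> 0 < lo ->
  (forall x, sqnorm x = 1 -> lo <= p.@[x] <= M) ->
  2 * M * (n * ff2 m)%:R + lo * (n * ff2 (m - 2))%:R <= 4 * lo * (n + m + 2 * r)%:R ->
  forall x, 0 <= (wick_inv m r p).@[x].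
Proof.
move=> nodes m_even m0 n0 e lo0 hp cond; apply: (euler_ge0 n0 (euler_wick_inv r e)).
move=> u u1; have /andP[plo pM] := hp u u1.
have Mp : 0 < M := lt_le_trans lo0 (le_trans plo pM).
have mE : m = (2 * m./2)%N by rewrite mul2n -[LHS]odd_double_half (negbTE m_even).
have [D DE] : exists D : R, D = (n + m + 2 * r)%:R by eexists.
have D0 : 0 < D by rewrite DE ltr0n; lia.
rewrite -DE in cond.
pose t j : R := \prod_(i < j) ((n * ff2 (m - 2 * i))%:R / (2 * i.+1%:R * D)).
have tS j : t j.+1 = t j * ((n * ff2 (m - 2 * j))%:R / (2 * j.+1%:R * D)).
  by rewrite /t big_ord_recr.
have fac0 j : 0 <= (n * ff2 (m - 2 * j))%:R / (2 * j.+1%:R * D) :> R.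
  by rewrite divr_ge0 ?ler0n // !mulr_ge0 ?ler0n // ltW.
have t0 j : 0 <= t j by apply: prodr_ge0 => i _.
pose rho : R := (n * ff2 (m - 2))%:R / (4 * D).
(* All factors but the first have numerator at most [n * ff2 (m - 2)] and denominator at least 2 * 2
   * D, which is [rho]. *)
have t_rho j : t j.+2 <= rho * t j.+1.
  rewrite tS mulrC; apply: ler_wpM2r; first exact: t0.
  have h : (ff2 (m - 2 * j.+1) <= ff2 (m - 2))%N by rewrite /ff2 leq_mul //; lia.
  rewrite /rho; apply: ler_pM => //.
  - by rewrite invr_ge0 !mulr_ge0 ?ler0n // ltW.
  - by rewrite ler_nat leq_mul2l h orbT.
  rewrite lef_pV2 ?posrE ?mulr_gt0 ?ltr0n //.
  apply: ler_wpM2r; first exact: ltW.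
  by rewrite -natrM ler_nat; lia.
have t1 : t 1%N = (n * ff2 m)%:R / (2 * D) by rewrite /t big_ord1 muln0 subn0 mulr1.
have rho0 : 0 <= rho by rewrite divr_ge0 ?ler0n // mulr_ge0 // ltW.
have sum_t J : (1 - rho) * \sum_(j < J) t j.+1 <= t 1%N.
  suff : (1 - rho) * \sum_(j < J) t j.+1 + t J.+1 <= t 1%N.
    by apply: le_trans; rewrite lerDl t0.
  elim: J => [|J IH]; first by rewrite big_ord0 mulr0 add0r.
  apply: le_trans IH; rewrite big_ord_recr /= mulrDr.
  by have := t_rho J; lra.
have main : M * t 1%N + lo * rho <= lo.
  rewrite t1 /rho -(ler_pM2r (_ : 0 < 4 * D)); last by rewrite mulr_gt0 // ltr0n.
  apply: le_trans (_ : 4 * lo * D <= _); last by rewrite mulrCA mulrA.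
  apply: le_trans cond; rewrite le_eqVlt; apply/orP; left; apply/eqP.
  by field; rewrite gt_eqF.
have bound : lo - M * \sum_(j < m./2) t j.+1 <= (wick_inv m r p).@[u].
  rewrite /wick_inv big_ord_recl mevalD mevalZ expr0 mul1r.
  have -> : inv_coef n R m r (@ord0 m./2) = 1.
    by rewrite /inv_coef big_ord0 !expr0 fact0 !mulr1 invr1 mulr1.
  rewrite mul1r; apply: lerD => //.
  rewrite raddf_sum mulr_sumr -sumrN; apply: ler_sum => j _; rewrite lift0 /=.
  rewrite mevalZ mevalM rmorphXn /= meval_nrm2 u1 expr1n mul1r.
  rewrite lerNl; apply: le_trans (ler_norm _) _; rewrite normrN normrM mulrC.
  have jm : (j.+1 <= m./2)%N by [].
  apply: le_trans (_ : (\prod_(i < j.+1) (n * ff2 (m - 2 * i))%:R) * M *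
     (\prod_(i < j.+1) (2 * i.+1%:R * D))^-1 <= _); last first.
    by rewrite /t prodf_div; lra.
  apply: ler_pM => //.
    apply: (@iter_lap_bound p m M nodes m_even e _ j.+1 u jm u1) => x x1; have /andP[h1 h2] := hp x x1.
    by rewrite ger0_norm // (le_trans (ltW lo0)).
  rewrite /inv_coef normrM normrX normrN1 expr1n mul1r normfV.
  have P0 : 0 < \prod_(i < j.+1) (2 * i.+1%:R * D).
    by apply: prodr_gt0 => i _; rewrite !mulr_gt0 ?ltr0n.
  have hfac (i : 'I_j.+1) : D <= n%:R + 2 * m%:R + 2 * r%:R - 2 * j.+1%:R + 2 * i%:R.
    rewrite DE (natrD _ (n + m) (2 * r)) (natrD _ n m) (natrM _ 2 r).
    have : 2 * j.+1%:R <= m%:R :> R by rewrite -natrM ler_nat [leqRHS]mE leq_mul2l.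
    have : 0 <= i%:R :> R by rewrite ler0n.
    lra.
  have le : \prod_(i < j.+1) (2 * i.+1%:R * D) <= 2 ^+ j.+1 * j.+1`!%:R *
      \prod_(i < j.+1) (n%:R + 2 * m%:R + 2 * r%:R - 2 * j.+1%:R + 2 * i%:R).
    rewrite fact_prod natr_prod big_add1 big_mkord /= -[X in 2 ^+ X](card_ord j.+1).
    rewrite -prodr_const -!big_split /=; apply: ler_prod => i _.
    by rewrite !mulr_ge0 ?ler0n ?(ltW D0) //= ler_wpM2l ?mulr_ge0 ?ler0n.
  rewrite ger0_norm ?(le_trans (ltW P0)) //.
  by rewrite lef_pV2 ?posrE // (lt_le_trans P0).
apply: le_trans bound; rewrite subr_ge0.
have r1 : 0 < 1 - rho.
  rewrite subr_gt0 -(ltr_pM2l lo0) mulr1.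
  have : 0 < M * t 1%N.
    rewrite t1 mulr_gt0 // divr_gt0 ?ltr0n ?mulr_gt0 ?ltr0n //.
    by rewrite muln_gt0 n0 /ff2; move: m0 m_even; clear; case: m => [|[|k]].
  by move: main; lra.
rewrite -(ler_pM2l r1) mulrCA; apply: le_trans (ler_wpM2l (ltW Mp) (sum_t _)) _.
by move: main; lra.
Qed.

End WickInverseBound.

(** * Hessians and quartics *)

Section HessianForm.
Variables (n : nat) (R : archiRcfType).
Implicit Types (p q f : {mpoly R[n]}) (u v x y : 'I_n -> R).

Definition hess f x y := (dird y (dird y f)).@[x].

Lemma dirdDl a b u v p :
  dird (fun i => a * u i + b * v i) p = a *: dird u p + b *: dird v p.
Proof.
rewrite /dird !scaler_sumr -big_split; apply: eq_bigr => i _.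
by rewrite scalerDl !scalerA.
Qed.

Lemma dird_ext u v p : u =1 v -> dird u p = dird v p.
Proof. by move=> e; apply: eq_bigr => i _; rewrite e. Qed.

Lemma dirdZl a u p : dird (fun i => a * u i) p = a *: dird u p.
Proof. by rewrite /dird scaler_sumr; apply: eq_bigr => i _; rewrite scalerA. Qed.

Lemma hess_scale (m : nat) f x y a b : euler m.+2%:R f ->
  hess f (fun i => a * x i) (fun i => b * y i) = a ^+ m * b ^+ 2 * hess f x y.
Proof.
move=> e; rewrite /hess !dirdZl [dird y (b *: _)]linearZ !mevalZ.
rewrite (@euler_meval _ _ m).
  by ring.
rewrite (_ : m%:R = m.+2%:R - 1 - 1); first exact/euler_dird/euler_dird.
by rewrite -[m.+2%:R]natr1 -[m.+1%:R]natr1; ring.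
Qed.

Lemma wick_inv_dird_ge0 m r f : (0 < n)%N ->
  (forall v, sqnorm v = 1 -> forall x, 0 <= (wick_inv m r (dird v (dird v f))).@[x]) ->
  forall x y, 0 <= (wick_inv m r (dird y (dird y f))).@[x].
Proof.
move=> n0 h x y; have [b [v [b0 v1 yE]]] := polar y n0.
rewrite (dird_ext _ yE) (dird_ext f yE) !dirdZl [dird v (b *: _)]linearZ.
rewrite /= scalerA -expr2 [wick_inv _ _ _]linearZ mevalZ mulr_ge0 ?sqr_ge0 //.
exact: h.
Qed.

Lemma gauss_E_nrm2X_gt0 k : (0 < n)%N -> 0 < gauss_E (nrm2 n R ^+ k).
Proof.
move=> n0; rewrite -[nrm2 n R ^+ k]mulr1 (gauss_E_nrm2X _ (euler1 n R)).
rewrite -mpolyX0 gauss_E_X [X in _ * X]big1 => [|i _]; last by rewrite mnm0E.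
rewrite mulr1; apply: prodr_gt0 => i _.
by rewrite addr0 ltr_pwDl ?ltr0n // mulr_ge0 ?ler0n.
Qed.

(* On the sphere the radial second derivative of [f] is [d (d - 1) f] and the
   tangential ones sum up to at least [(n - 1) lo]; compare Gaussian averages. *)
Lemma hess_ratio f k (lo M : R) : (1 < n)%N -> euler (2 * k).+2%:R f ->
  (forall x y, sqnorm x = 1 -> sqnorm y = 1 -> lo <= hess f x y <= M) ->
  (2 * k).+1%:R * lo <= M.
Proof.
move=> n1 e h; have n0 := ltnW n1; set d : R := (2 * k).+2%:R in e *.
have d1 : d - 1 = (2 * k).+1%:R by rewrite /d -natr1 addrK.
have eN : euler d (nrm2 n R ^+ k.+1).
  rewrite (_ : d = k.+1%:R * 2); first exact/eulerXn/euler_nrm2.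
  by rewrite /d -natrM; congr _%:R; lia.
have hess_self u : hess f u u = d * (d - 1) * f.@[u] by apply: dird2_self.
have e1 u : sqnorm u = 1 -> (nrm2 n R ^+ k.+1).@[u] = 1.
  by move=> u1; rewrite rmorphXn /= meval_nrm2 u1 expr1n.
have q1 : 0 <= gauss_E (nrm2 n R * lap f - (d * (d - 1)) *: f
     - ((n%:R - 1) * lo) *: nrm2 n R ^+ k.+1).
  apply: gauss_E_ge0; apply: (@euler_ge0 _ _ (2 * k).+2) => // [|u u1].
    apply: eulerD; last by rewrite -scaleNr; apply: eulerZ.
    apply: eulerD; last by rewrite -scaleNr; apply: eulerZ.
    rewrite (_ : _%:R = 2 + (d - 2)); last by rewrite /d; ring.
    by apply: eulerM (euler_lap e); apply: euler_nrm2.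
  rewrite !mevalB !mevalZ mevalM e1 // meval_nrm2 u1 mul1r mulr1 -hess_self.
  have [o [o0 orth on]] := orthobasis (Ordinal n0) u1.
  have sq1 j : sqnorm (o j) = 1.
    by rewrite -[RHS]/(true%:R) -(eqxx j) -on; apply: eq_bigr => a _; rewrite expr2.
  rewrite (lap_orthobasis f orth) raddf_sum (bigD1 (Ordinal n0)) //=.
  rewrite (_ : (dird _ _).@[u] = hess f u u); last first.
    by rewrite /hess !(dird_ext _ o0).
  rewrite [_ - hess f u u]addrAC subrr add0r subr_ge0.
  apply: le_trans (_ : \sum_(i < n | i != Ordinal n0) lo <= _).
    rewrite sumr_const cardC1 card_ord -[lo *+ _]mulr_natl -subn1 natrB //.
  by apply: ler_sum => i _; have /andP[] := h u (o i) u1 (sq1 i).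
have q2 : 0 <= gauss_E (M *: nrm2 n R ^+ k.+1 - (d * (d - 1)) *: f).
  apply: gauss_E_ge0; apply: (@euler_ge0 _ _ (2 * k).+2) => // [|u u1].
    by apply: eulerD; [apply: eulerZ | rewrite -scaleNr; apply: eulerZ].
  rewrite mevalB !mevalZ e1 // mulr1 -hess_self subr_ge0.
  by have /andP[] := h u u u1 u1.
(* The average of |g|^2 lap f is (n + d - 2) d times that of f. Subtracting d (d - 1) times the
   latter leaves (n - 1) d times it, so that n - 1 cancels in [q1]. *)
move: q1 q2; rewrite !linearB !linearZ /= (gauss_E_nrm2 (euler_lap e)) (gauss_E_lap e).
have := gauss_E_nrm2X_gt0 k.+1 n0; move: (gauss_E _) (gauss_E f) => E F E0 q1 q2.
have N1 : 0 < n%:R - 1 :> R by rewrite subr_gt0 ltr1n.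
have : lo * E <= d * F by rewrite -(ler_pM2l N1); lra.
rewrite -d1 => hF.
have d10 : 0 <= d - 1 by rewrite d1 ler0n.
have h1 := ler_wpM2l d10 hF.
by rewrite -(ler_pM2r E0); move: h1 q2; lra.
Qed.

End HessianForm.

(** Under full symmetry only the number of arguments equal to [v] matters. The type [T] is arbitrary
    because both vectors and indices will take its place. *)
Lemma sym4_two_points (T R : Type) (Q : T -> T -> T -> T -> R) (u v : T) :
  (forall x y z w, Q x y z w = Q y x z w) -> (forall x y z w, Q x y z w = Q x z y w) ->
  (forall x y z w, Q x y z w = Q x y w z) ->
  ([/\ Q v u u u = Q u u u v, Q u v u u = Q u u u v & Q u u v u = Q u u u v] *
  ([/\ Q u v u v = Q u u v v, Q u v v u = Q u u v v & Q v u u v = Q u u v v] *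
   (Q v u v u = Q u u v v) * (Q v v u u = Q u u v v)) *
  [/\ Q v u v v = Q u v v v, Q v v u v = Q u v v v & Q v v v u = Q u v v v])%type.
Proof.
move=> C12 C23 C34.
have c8 : Q u v u v = Q u u v v by rewrite (C23 u v u).
have c7 : Q u v v u = Q u u v v by rewrite (C34 u v v) c8.
have c5 : Q v u v u = Q u u v v by rewrite (C12 v u) c7.
have c11 : Q v u v v = Q u v v v by rewrite (C12 v u).
have c10 : Q v v u v = Q u v v v by rewrite (C23 v v u) c11.
do !split=> //.
- by rewrite (C12 v u) (C23 u v) (C34 u u v).
- by rewrite (C23 u v) (C34 u u v).
- by rewrite (C12 v u) c8.
- by rewrite (C23 v v u) c5.
- by rewrite (C34 v v v) c10.
Qed.

Lemma sym4_plane n (R : comRingType) (Q : ('I_n -> R) -> ('I_n -> R) -> ('I_n -> R) -> ('I_n -> R) -> R)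
    a b c d u v :
  (forall x y z w, Q x y z w = Q y x z w) -> (forall x y z w, Q x y z w = Q x z y w) ->
  (forall x y z w, Q x y z w = Q x y w z) ->
  (forall a b u v y z w, Q (fun i => a * u i + b * v i) y z w = a * Q u y z w + b * Q v y z w) ->
  let p i := a * u i + b * v i in let q i := c * u i + d * v i in
  Q p p q q =
  a ^+ 2 * c ^+ 2 * Q u u u u + (2 * a * b * c ^+ 2 + 2 * a ^+ 2 * c * d) * Q u u u v
  + (a ^+ 2 * d ^+ 2 + 4 * a * b * c * d + b ^+ 2 * c ^+ 2) * Q u u v v
  + (2 * a * b * d ^+ 2 + 2 * b ^+ 2 * c * d) * Q u v v v + b ^+ 2 * d ^+ 2 * Q v v v v.
Proof.
move=> C12 C23 C34 lin /=.
have lin2 x z w : Q x (fun i => a * u i + b * v i) z w = a * Q x u z w + b * Q x v z w.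
  by rewrite C12 lin !(C12 _ x).
have lin3 x y w : Q x y (fun i => c * u i + d * v i) w = c * Q x y u w + d * Q x y v w.
  by rewrite C23 C12 lin !(C12 _ x) !(C23 _ y).
have lin4 x y z : Q x y z (fun i => c * u i + d * v i) = c * Q x y z u + d * Q x y z v.
  by rewrite C34 lin3 !(C34 _ _ _ z).
rewrite lin !lin2 !lin3 !lin4.
have [[[c1 c2 c3] [[[c8 c7 c6] c5] c4]] [c11 c10 c9]] := sym4_two_points u v C12 C23 C34.
by rewrite c1 c2 c3 c4 c5 c6 c7 c8 c9 c10 c11; ring.
Qed.

Lemma sym4_comb34 n (R : comRingType) (Q : ('I_n -> R) -> ('I_n -> R) -> ('I_n -> R) -> ('I_n -> R) -> R)
    x c d u v :
  (forall x y z w, Q x y z w = Q y x z w) -> (forall x y z w, Q x y z w = Q x z y w) ->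
  (forall x y z w, Q x y z w = Q x y w z) ->
  (forall a b u v y z w, Q (fun i => a * u i + b * v i) y z w = a * Q u y z w + b * Q v y z w) ->
  let q i := c * u i + d * v i in
  Q x x q q = c ^+ 2 * Q x x u u + 2 * c * d * Q x x u v + d ^+ 2 * Q x x v v.
Proof.
move=> C12 C23 C34 lin q.
have lin3 y z w : Q y z q w = c * Q y z u w + d * Q y z v w.
  by rewrite C23 C12 lin !(C12 _ y) !(C23 _ z).
have lin4 y z w : Q y z w q = c * Q y z w u + d * Q y z w v.
  by rewrite C34 lin3 !(C34 _ _ _ w).
by rewrite lin3 !lin4 (C34 x x v u); ring.
Qed.

(** * Estimates for the 4-linear form of a quartic *)

Section Quartic.
Variables (n : nat) (R : archiRcfType) (f : {mpoly R[n]}) (lo M : R).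
Hypothesis f4 : euler 4 f.
Hypothesis hf : forall x y, sqnorm x = 1 -> sqnorm y = 1 -> lo <= hess f x y <= M.
Implicit Types (u v w x y z : 'I_n -> R).

(* The symmetric 4-linear form with [hess f x y = qf x x y y]. *)
Definition qf x y z w := 2^-1 * (dird x (dird y (dird z (dird w f)))).@[fun=> 0].

Lemma qfC12 x y z w : qf x y z w = qf y x z w.
Proof. by rewrite /qf dirdC. Qed.
Lemma qfC23 x y z w : qf x y z w = qf x z y w.
Proof. by rewrite /qf (dirdC y z). Qed.
Lemma qfC34 x y z w : qf x y z w = qf x y w z.
Proof. by rewrite /qf (dirdC z w). Qed.

Lemma qfDl a b u v y z w :
  qf (fun i => a * u i + b * v i) y z w = a * qf u y z w + b * qf v y z w.
Proof. by rewrite /qf dirdDl mevalD !mevalZ; ring. Qed.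

Lemma hess_qf x y : hess f x y = qf x x y y.
Proof.
have e2 : euler 2 (dird y (dird y f)).
  by rewrite (_ : 2 = 4 - 1 - 1 :> R); [apply/euler_dird/euler_dird | ring].
rewrite /hess /qf.
have e0 : euler 0 (dird x (dird x (dird y (dird y f)))).
  by rewrite (_ : 0 = 2 - 1 - 1 :> R); [apply/euler_dird/euler_dird | ring].
have := dird2_self x e2; rewrite (euler_const e0) !mevalC => ->.
by field.
Qed.

Lemma hess_plane a b c d u v :
  hess f (fun i => a * u i + b * v i) (fun i => c * u i + d * v i) =
  a ^+ 2 * c ^+ 2 * qf u u u u + (2 * a * b * c ^+ 2 + 2 * a ^+ 2 * c * d) * qf u u u v
  + (a ^+ 2 * d ^+ 2 + 4 * a * b * c * d + b ^+ 2 * c ^+ 2) * qf u u v v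
  + (2 * a * b * d ^+ 2 + 2 * b ^+ 2 * c * d) * qf u v v v + b ^+ 2 * d ^+ 2 * qf v v v v.
Proof.
by rewrite hess_qf; apply: sym4_plane; [exact: qfC12 | exact: qfC23 | exact: qfC34 | exact: qfDl].
Qed.

Lemma hess_bounds x y : (0 < n)%N ->
  lo * (sqnorm x * sqnorm y) <= hess f x y <= M * (sqnorm x * sqnorm y).
Proof.
move=> n0; have [a [u [a0 u1 xE]]] := polar x n0; have [b [v [b0 v1 yE]]] := polar y n0.
have sq c w z : sqnorm w = 1 -> z =1 (fun i => c * w i) -> sqnorm z = c ^+ 2.
  move=> w1 zE; rewrite /sqnorm -[RHS]mulr1 -w1 mulr_sumr.
  by apply: eq_bigr => i _; rewrite zE exprMn.
rewrite (sq a u x u1 xE) (sq b v y v1 yE).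
have -> : hess f x y = hess f (fun i => a * u i) (fun i => b * v i).
  rewrite /hess (meval_eq _ xE); congr meval.
  by rewrite (dird_ext _ yE) (dird_ext f yE).
have /andP[h1 h2] := hf u1 v1.
rewrite (@hess_scale _ _ 2) // (mulrC lo) (mulrC M).
by rewrite !ler_wpM2l ?mulr_ge0 ?sqr_ge0.
Qed.

(** Evaluate at the point u + v in the direction u - v, both of squared norm 2: the terms of odd
    degree in [v] cancel. *)
Lemma hess_perp u v : sqnorm u = 1 -> sqnorm v = 1 -> dot u v = 0 ->
  4 * lo <= qf u u u u - 2 * qf u u v v + qf v v v v.
Proof.
move=> u1 v1 uv.
have n0 : (0 < n)%N.
  case: (n) u u1 {v v1 uv} => // u; rewrite /sqnorm big_ord0 => /eqP.
  by rewrite eq_sym oner_eq0.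
have /andP[+ _] := hess_bounds (fun i => 1 * u i + 1 * v i) (fun i => 1 * u i + (-1) * v i) n0.
rewrite !sqnorm_comb // hess_plane.
move: (qf u u u u) (qf u u u v) (qf u u v v) (qf u v v v) (qf v v v v) => A B C D E.
lra.
Qed.

(** For fixed [y] the form is quadratic in [x], so its Laplacian is a constant, twice the sum of its
    values on an orthonormal basis. In a basis containing [y], [hess_perp] bounds each of the other
    n - 1 values by M - 2 lo in place of M; this gain raises n + 2 to 3 n in the condition on r. *)
Lemma wick_inv_quartic_ge0 r : (0 < n)%N ->
  n%:R * M <= lo * (3 * n%:R + 2 * r%:R) ->
  forall x y, 0 <= (wick_inv 2 r (dird y (dird y f))).@[x].
Proof.
move=> n0 cond.
have e2 y : euler 2%:R (dird y (dird y f)).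
  by rewrite (_ : 2%:R = 4 - 1 - 1 :> R); [apply/euler_dird/euler_dird | ring].
have key x y : sqnorm x = 1 -> sqnorm y = 1 -> 0 <= (wick_inv 2 r (dird y (dird y f))).@[x].
  move=> x1 y1; rewrite /wick_inv big_ord_recl big_ord1 mevalD !mevalZ lift0.
  rewrite /= expr0 expr1 mul1r mevalM meval_nrm2 x1 mul1r -/(hess f x y).
  rewrite /inv_coef big_ord0 big_ord1 /= !expr0 fact0 !expr1 factS fact0.
  have [o [o0 orth on]] := orthobasis (Ordinal n0) y1.
  have sq1 j : sqnorm (o j) = 1.
    by rewrite -[RHS]/(true%:R) -(eqxx j) -on; apply: eq_bigr => a _; rewrite expr2.
  have lapE : (lap (dird y (dird y f))).@[x] = 2 * \sum_i hess f (o i) y.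
    rewrite (lap_orthobasis _ orth) raddf_sum mulr_sumr; apply: eq_bigr => i _ /=.
    have e0 : euler 0 (dird (o i) (dird (o i) (dird y (dird y f)))).
      by rewrite (_ : 0 = 2 - 1 - 1 :> R); [apply/euler_dird/euler_dird | ring].
    have := dird2_self (o i) (e2 y); rewrite (euler_const e0) !mevalC => ->.
    by rewrite -/(hess f (o i) y); move: (hess _ _ _) => h; ring.
  have lapB : \sum_i hess f (o i) y <= n%:R * M - 2 * (n%:R - 1) * lo.
    rewrite (bigD1 (Ordinal n0)) //=.
    have b0 : hess f (o (Ordinal n0)) y <= M by have /andP[] := hf (sq1 (Ordinal n0)) y1.
    have : \sum_(i < n | i != Ordinal n0) hess f (o i) y <=
        \sum_(i < n | i != Ordinal n0) (M - 2 * lo).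
      apply: ler_sum => i i0; have oy : dot (o i) y = 0.
        rewrite -[RHS]/(false%:R) -(negbTE i0) -on; apply: eq_bigr => a _; by rewrite o0.
      have := hess_perp (sq1 i) y1 oy; have /andP[_] := hf (sq1 i) (sq1 i).
      have /andP[_] := hf y1 y1; rewrite !hess_qf.
      by move: (qf _ _ _ _) (qf _ _ _ _) (qf _ _ _ _) => A B C; lra.
    rewrite sumr_const cardC1 card_ord -[(M - _) *+ _]mulr_natl -subn1 natrB //.
    by move: (\sum_(i < n | _) _) (hess _ _ _) b0 => A B; lra.
  rewrite lapE; have /andP[h1 _] := hess_bounds x y n0; rewrite x1 y1 in h1.
  set D : R := n%:R + 2 + 2 * r%:R.
  have D0 : 0 < D.
    have : 0 <= n%:R :> R by rewrite ler0n.
    have : 0 <= r%:R :> R by rewrite ler0n.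
    by rewrite /D; lra.
  rewrite (_ : 1 / _ * _ + _ = hess f x y - (\sum_i hess f (o i) y) / D); last first.
    by rewrite /D; field; rewrite gt_eqF.
  rewrite subr_ge0 ler_pdivrMr //; apply: le_trans lapB _.
  have := ler_wpM2r (ltW D0) h1; rewrite /D; lra.
apply: wick_inv_dird_ge0 => // v v1; have e := @euler_wick_inv n R 2 r _ (e2 v).
by apply: (euler_ge0 n0 e) => u u1; apply: key.
Qed.

Lemma qf_orthonormal u v : sqnorm u = 1 -> sqnorm v = 1 -> dot u v = 0 ->
  [/\ 6 * lo - M <= qf u u u u <= M, lo <= qf u u v v <= M - 2 * lo &
      M <= 63 / 20 * lo -> `|qf u u u v| <= lo / 5].
Proof.
move=> u1 v1 uv.
have n0 : (0 < n)%N.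
  case: (n) u u1 {v v1 uv} => // u; rewrite /sqnorm big_ord0 => /eqP.
  by rewrite eq_sym oner_eq0.
have h a b c d := hess_bounds (fun i => a * u i + b * v i) (fun i => c * u i + d * v i) n0.
have h1 := hess_perp u1 v1 uv.
(* In the names A, ..., E given below to the five coefficients, [h5] and [h6] bound B + D from both
   sides, and the orthogonal pairs of [h7] and [h8] bound B - D; their half sum is B. *)
have h2 := h 1 0 1 0; have h3 := h 0 1 0 1; have h4 := h 1 0 0 1.
have h5 := h 1 1 1 1; have h6 := h 1 (-1) 1 (-1).
have h7 := h 2 1 (-1) 2; have h8 := h 2 (-1) 1 2.
rewrite !sqnorm_comb // !hess_plane in h2 h3 h4 h5 h6 h7 h8.
move: (qf u u u u) (qf u u u v) (qf u u v v) (qf u v v v) (qf v v v v)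
  h1 h2 h3 h4 h5 h6 h7 h8 => A B C D E h1.
move=> /andP[g1 g2] /andP[g3 g4] /andP[g5 g6] /andP[_ g7] /andP[_ g8] /andP[g9 _] /andP[g10 _].
have {}g1 : lo <= A by clear -g1; lra.
have {}g2 : A <= M by clear -g2; lra.
have {}g3 : lo <= E by clear -g3; lra.
have {}g4 : E <= M by clear -g4; lra.
have {}g5 : lo <= C by clear -g5; lra.
have {}g7 : A + 4 * B + 6 * C + 4 * D + E <= 4 * M by clear -g7; lra.
have {}g8 : A - 4 * B + 6 * C - 4 * D + E <= 4 * M by clear -g8; lra.
have {}g9 : 25 * lo <= 4 * A - 12 * B + C + 12 * D + 4 * E by clear -g9; lra.
have {}g10 : 25 * lo <= 4 * A + 12 * B + C - 12 * D + 4 * E by clear -g10; lra.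
split; [by apply/andP; split; clear -h1 g1 g2 g3 g4 g5; lra
       |by apply/andP; split; clear -h1 g1 g2 g3 g4 g5; lra |].
by move=> ?; rewrite ler_norml; apply/andP; split; lra.
Qed.

(** The directions v + w and v - w give 2 lo from below, while the pure terms [qf u u v v] and
    [qf u u w w] are at most M - 2 lo. *)
Lemma qf_orthonormal3 u v w : sqnorm u = 1 -> sqnorm v = 1 -> sqnorm w = 1 ->
  dot u v = 0 -> dot u w = 0 -> dot v w = 0 -> `|qf u u v w| <= M - 3 * lo.
Proof.
move=> u1 v1 w1 uv uw vw.
have [_ /andP[_ c1] _] := qf_orthonormal u1 v1 uv.
have [_ /andP[_ c2] _] := qf_orthonormal u1 w1 uw.
have n0 : (0 < n)%N.
  case: (n) u u1 {v v1 uv w w1 uw vw c1 c2} => // u; rewrite /sqnorm big_ord0 => /eqP.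
  by rewrite eq_sym oner_eq0.
have h s : s ^+ 2 = 1 -> 2 * lo <= qf u u v v + 2 * s * qf u u v w + qf u u w w.
  move=> s1; have /andP[+ _] := hess_bounds u (fun i => 1 * v i + s * w i) n0.
  rewrite sqnorm_comb // u1 s1 hess_qf.
  rewrite (@sym4_comb34 _ _ (qf)) ?s1; [|exact: qfC12|exact: qfC23|exact: qfC34|exact: qfDl].
  by clear c1 c2; move: (qf u u v v) (qf u u v w) (qf u u w w) => A B C; lra.
have hp := h 1 (expr1n _ _); have hm := h (-1) (etrans (sqrrN 1) (expr1n _ _)).
move: (qf u u v v) (qf u u v w) (qf u u w w) c1 c2 hp hm => A B C c1 c2 hp hm.
by rewrite ler_norml; apply/andP; split; lra.
Qed.

End Quartic.

(** * Quartic Hessians that are sums of squares without multiplier *)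

Section Catalecticant.
Variables (n : nat) (R : archiRcfType) (f : {mpoly R[n]}).
Hypothesis f4 : euler 4 f.
Implicit Types (u v w x y z : 'I_n -> R) (X : 'I_n -> 'I_n -> R).

Definition bvec (i : 'I_n) : 'I_n -> R := fun a => (i == a)%:R.

Lemma qf_suml x y z w : qf f x y z w = \sum_i x i * qf f (bvec i) y z w.
Proof.
have dirdE v p : dird v p = \sum_i v i *: dird (bvec i) p.
  apply: eq_bigr => i _; congr (_ *: _); rewrite /dird (bigD1 i) //=.
  rewrite /bvec eqxx scale1r big1 ?addr0 // => j /negbTE.
  by rewrite eq_sym => ->; rewrite scale0r.
rewrite {1}/qf dirdE raddf_sum mulr_sumr; apply: eq_bigr => i _ /=.
by rewrite mevalZ mulrCA.
Qed.

(** The catalecticant, that is, the 4-linear form flattened to a quadratic form on matrices. At x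
    y^T it equals [qf f x y x y], which by symmetry is the Hessian form; a decomposition into
    squares on all matrices therefore restricts to one of y^T H_f y. *)
Definition cat_form X := \sum_i \sum_k \sum_j \sum_l
  X i k * X j l * qf f (bvec i) (bvec k) (bvec j) (bvec l).

Lemma cat_form_rank1 x y : cat_form (fun i k => x i * y k) = qf f x y x y.
Proof.
have s2 u v w z : qf f u v w z = \sum_i v i * qf f u (bvec i) w z.
  by rewrite (qfC12 f u) qf_suml; apply: eq_bigr => i _; rewrite (qfC12 f (bvec i)).
have s3 u v w z : qf f u v w z = \sum_i w i * qf f u v (bvec i) z.
  by rewrite (qfC23 f u) s2; apply: eq_bigr => i _; rewrite (qfC23 f u).
have s4 u v w z : qf f u v w z = \sum_i z i * qf f u v w (bvec i).
  by rewrite (qfC34 f u) s3; apply: eq_bigr => i _; rewrite (qfC34 f u).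
rewrite qf_suml; apply: eq_bigr => i _; rewrite s2 mulr_sumr; apply: eq_bigr => k _.
rewrite s3 !mulr_sumr; apply: eq_bigr => j _; rewrite s4 !mulr_sumr.
by apply: eq_bigr => l _; move: (qf _ _ _ _ _) => q; ring.
Qed.

Lemma cat_form_sos : (forall X, 0 <= cat_form X) -> biform_sos 1 (hess f).
Proof.
move=> psd.
pose G (a b : 'I_n * {ffun 'I_1 -> 'I_n}) :=
  qf f (bvec a.1) (bvec (a.2 ord0)) (bvec b.1) (bvec (b.2 ord0)).
have swap F : \sum_(a : 'I_n * {ffun 'I_1 -> 'I_n}) F a.1 (a.2 ord0) =
    \sum_i \sum_k F i k :> R.
  rewrite -(pair_bigA _ (fun i (w : {ffun 'I_1 -> 'I_n}) => F i (w ord0))) /=.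
  apply: eq_bigr => i _; rewrite (reindex (fun k : 'I_n => [ffun=> k])) /=.
    by apply: eq_bigr => k _; rewrite ffunE.
  exists (fun w : {ffun 'I_1 -> 'I_n} => w ord0) => [k _|w _]; first by rewrite ffunE.
  by apply/ffunP => a; rewrite ffunE (ord1 a).
have GE X : \sum_(a : 'I_n * {ffun 'I_1 -> 'I_n}) \sum_(b : 'I_n * {ffun 'I_1 -> 'I_n})
    X a.1 (a.2 ord0) * X b.1 (b.2 ord0) * G a b = cat_form X.
  rewrite (swap (fun i k => \sum_(b : 'I_n * {ffun 'I_1 -> 'I_n}) X i k * X b.1 (b.2 ord0) *
     qf f (bvec i) (bvec k) (bvec b.1) (bvec (b.2 ord0)))).
  apply: eq_bigr => i _; apply: eq_bigr => k _.
  by rewrite (swap (fun j l => X i k * X j l * qf f (bvec i) (bvec k) (bvec j) (bvec l))).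
have Gs a b : G a b = G b a.
  rewrite /G (qfC23 f (bvec a.1)) (qfC12 f (bvec a.1)) (qfC34 f (bvec b.1)).
  by rewrite (qfC23 f (bvec b.1)).
have := @psd_biform_sos _ _ 1 G Gs.
have E (z : 'I_n * {ffun 'I_1 -> 'I_n} -> R) : z =1 (fun a => z (a.1, [ffun=> a.2 ord0])).
  move=> [i w] /=; congr (z (i, _)); apply/ffunP => a.
  by rewrite ffunE (ord1 a).
case=> [z|L hL].
  under eq_bigr do under eq_bigr do rewrite (E z) [in X in _ * X * _](E z).
  by rewrite (GE (fun i k => z (i, [ffun=> k]))).
exists L => x y; rewrite -hL.
rewrite (hess_qf f4) (qfC23 f x x) (qfC12 f x y) (qfC34 f y x) -cat_form_rank1 -GE.
apply: eq_bigr => a _; apply: eq_bigr => b _.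
by rewrite /bimon !big_ord1.
Qed.

End Catalecticant.

(** Here [a], [b] are the diagonal entries of a 2 x 2 matrix and [z] is the sum of the other two;
    the hypothesis is the case of rank one. *)
Lemma binary_cat_ge0 (R : rcfType) (A B C D E : R) :
  (forall x0 x1 y0 y1, 0 <= A * (x0 * y0) ^+ 2 + 2 * B * (x0 * y0) * (x0 * y1 + x1 * y0)
     + C * ((x0 * y1 + x1 * y0) ^+ 2 + 2 * (x0 * y0) * (x1 * y1))
     + 2 * D * (x0 * y1 + x1 * y0) * (x1 * y1) + E * (x1 * y1) ^+ 2) ->
  forall a b z, 0 <= A * a ^+ 2 + 2 * B * a * z + C * (z ^+ 2 + 2 * a * b)
     + 2 * D * z * b + E * b ^+ 2.
Proof.
move=> h a b z.
have [a0|a0] := eqVneq a 0.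
  have := h 0 1 z b; rewrite a0; congr (0 <= _); ring.
(* A symmetric matrix of nonpositive determinant is a symmetrized rank one matrix. *)
have [det|det] := leP (4 * a * b) (z ^+ 2).
  pose s := Num.sqrt (z ^+ 2 - 4 * a * b).
  have s2 : s ^+ 2 = z ^+ 2 - 4 * a * b by rewrite sqr_sqrtr // subr_ge0.
  have bE : b = (z ^+ 2 - s ^+ 2) / (4 * a) by rewrite s2; field.
  (* The two linear factors of the quadratic form a X^2 + z X Y + b Y^2, whose discriminant is
     [s ^+ 2]. *)
  have := h a ((z + s) / 2) 1 ((z - s) / (2 * a)).
  rewrite bE; congr (0 <= _); field.
  by [].
(* Otherwise [4 a] times it is a sum of two rank one matrices [w w^T]. *)
pose d := 4 * a * b - z ^+ 2; have d0 : 0 < d by rewrite subr_gt0.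
have bE : b = (z ^+ 2 + d) / (4 * a) by rewrite /d; field.
have h1 := h (2 * a) z (2 * a) z.
have h2 := h (2 * a) z 0 1.
have h3 := h 0 1 0 1.
rewrite -(pmulr_rge0 _ (_ : 0 < 16 * a ^+ 2)); last by rewrite mulr_gt0 ?ltr0n // exprn_even_gt0.
(* With w = (2 a, z) and e = (0, 1), this is the expansion at w w^T + d e e^T. By symmetry of the
   coefficients, the cross term is 2 d times the Hessian form at the pair (w, e), hence nonnegative
   by [h2]. *)
have := addr_ge0 (addr_ge0 h1 (mulr_ge0 (ltW d0) (mulr_ge0 (ler0n _ 2) h2)))
  (mulr_ge0 (sqr_ge0 d) h3).
rewrite bE; congr (0 <= _); field.
by [].
Qed.

Lemma sum4_two_points (R : comRingType) (Q : 'I_2 -> 'I_2 -> 'I_2 -> 'I_2 -> R)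
    (X : 'I_2 -> 'I_2 -> R) :
  (forall x y z w, Q x y z w = Q y x z w) -> (forall x y z w, Q x y z w = Q x z y w) ->
  (forall x y z w, Q x y z w = Q x y w z) ->
  let u := ord0 in let v := lift ord0 ord0 in
  let a := X u u in let b := X v v in let z := X u v + X v u in
  \sum_i \sum_k \sum_j \sum_l X i k * X j l * Q i k j l =
  Q u u u u * a ^+ 2 + 2 * Q u u u v * a * z + Q u u v v * (z ^+ 2 + 2 * a * b)
     + 2 * Q u v v v * z * b + Q v v v v * b ^+ 2.
Proof.
move=> C12 C23 C34 u v a b z.
rewrite !big_ord_recl !big_ord0 -/v -/u /a /b /z; clear a b z; clearbody v u.
have [[[c1 c2 c3] [[[c8 c7 c6] c5] c4]] [c11 c10 c9]] := sym4_two_points u v C12 C23 C34.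
by rewrite c1 c2 c3 c4 c5 c6 c7 c8 c9 c10 c11; ring.
Qed.

Lemma binary_quartic_sos (R : archiRcfType) (f : {mpoly R[2]}) : euler 4 f ->
  (forall x y, 0 <= hess f x y) -> biform_sos 1 (hess f).
Proof.
move=> f4 h; apply: cat_form_sos => // X.
rewrite /cat_form (@sum4_two_points _ (fun i k j l => qf f (bvec R i) (bvec R k) (bvec R j) (bvec R l))).
- apply: binary_cat_ge0 => x0 x1 y0 y1.
  have := h (fun i => x0 * bvec R ord0 i + x1 * bvec R (lift ord0 ord0) i)
    (fun i => y0 * bvec R ord0 i + y1 * bvec R (lift ord0 ord0) i).
  rewrite hess_plane //.
  move: (qf f _ _ _ _) (qf f _ _ _ _) (qf f _ _ _ _) (qf f _ _ _ _) (qf f _ _ _ _).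
  by move=> A B C D E; congr (0 <= _); ring.
- by move=> *; apply: qfC12.
- by move=> *; apply: qfC23.
- by move=> *; apply: qfC34.
Qed.

Section TernaryQuartic.
Variable R : archiRcfType.

Lemma sqnorm_bvec n (i : 'I_n) : sqnorm (bvec R i) = 1.
Proof.
rewrite /sqnorm /bvec -[RHS](sum_delta i (fun=> 1)); apply: eq_bigr => a _.
by case: (i == a); rewrite ?expr1n ?mul1r // expr0n mul0r.
Qed.

Lemma dot_bvec n (i j : 'I_n) : i != j -> dot (bvec R i) (bvec R j) = 0.
Proof. by move=> ij; rewrite /dot sum_delta /bvec eq_sym (negbTE ij). Qed.

Section Entries.
Variables (n : nat) (f : {mpoly R[n]}) (lo M : R).
Hypotheses (n1 : (1 < n)%N) (lo0 : 0 < lo) (lM : M <= 63 / 20 * lo) (f4 : euler 4 f).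
Hypothesis hf : forall x y, sqnorm x = 1 -> sqnorm y = 1 -> lo <= hess f x y <= M.

Let q (i k j l : 'I_n) := qf f (bvec R i) (bvec R k) (bvec R j) (bvec R l).
(** [lo * d] is the 4-linear form of (lo / 4) |x|^4, the quartic with Hessian form lo (|x|^2 |y|^2 +
    2 <x, y>^2) and ratio 3. *)
Let d (i k j l : 'I_n) : R :=
  (i == k)%:R * (j == l)%:R + (i == j)%:R * (k == l)%:R + (i == l)%:R * (k == j)%:R.

Let near i k j l := `|q i k j l - lo * d i k j l| <= lo / 5.

Let near_pair i j l : near i i j l.
Proof.
rewrite /near /d eqxx.
have q3 (u v : 'I_n) (uv : u != v) :=
  qf_orthonormal f4 hf (sqnorm_bvec u) (sqnorm_bvec v) (dot_bvec uv).
have [jl|jl] := eqVneq j l.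
  rewrite -jl; have [ij|ij] := eqVneq i j.
    have [k ik] : exists k : 'I_n, i != k.
      apply/existsP; rewrite -negb_forall; apply/negP => /forallP h.
      have := h (Ordinal n1); have := h (Ordinal (ltnW n1)).
      by move=> /eqP -> /eqP/(congr1 val).
    have [/andP[h1 h2] _ _] := q3 i k ik; rewrite -ij /q.
    move: (qf _ _ _ _ _) h1 h2 => A h1 h2; rewrite ler_norml !mulr1n ?mulr0n.
    by apply/andP; split; move: lo0 lM; lra.
  have [_ /andP[h1 h2] _] := q3 i j ij.
  rewrite /q; move: (qf _ _ _ _ _) h1 h2 => A h1 h2; rewrite ler_norml !mulr1n ?mulr0n.
  by apply/andP; split; move: lo0 lM; lra.
have [ij|ij] := eqVneq i j.
  have il : i != l by rewrite ij.
  have [_ _ /(_ lM)] := q3 i l il; rewrite -ij (negbTE il) /q /=.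
  by rewrite !(mulr0, mul0r, addr0) subr0.
have [il|il] := eqVneq i l.
  have [_ _ /(_ lM)] := q3 i j ij; rewrite -il /q /=.
  by rewrite !(mulr0, mul0r, addr0) subr0 (qfC34 f (bvec R i) (bvec R i)).
have := qf_orthonormal3 f4 hf (sqnorm_bvec i) (sqnorm_bvec j) (sqnorm_bvec l)
  (dot_bvec ij) (dot_bvec il) (dot_bvec jl).
rewrite /q !(mulr0, mul0r, addr0) subr0 => /le_trans; apply.
move: lo0 lM; lra.
Qed.

Let near12 i k j l : near i k j l -> near k i j l.
Proof. by rewrite /near /q /d (qfC12 f (bvec R k)) (eq_sym k i) [_ + (k == j)%:R * _ + _]addrAC [(k == l)%:R * _]mulrC [(k == j)%:R * _]mulrC. Qed.
Let near23 i k j l : near i k j l -> near i j k l.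
Proof. by rewrite /near /q /d (qfC23 f (bvec R i) (bvec R j)) [(i == k)%:R * _ + _]addrC (eq_sym j k). Qed.
Let near34 i k j l : near i k j l -> near i k l j.
Proof. by rewrite /near /q /d (qfC34 f _ _ (bvec R l)) (eq_sym l j) [_ + (i == l)%:R * _ + _]addrAC. Qed.

(** Two of the four indices coincide, as there are at most three values, and transpositions bring
    them to the front, where [near_pair] applies. *)
Lemma qf_near i k j l : (n <= 3)%N -> `|q i k j l - lo * d i k j l| <= lo / 5.
Proof.
move=> n3; rewrite -/(near i k j l).
have [<-|ik] := eqVneq i k; first exact: near_pair.
have [<-|ij] := eqVneq i j; first exact/near23/near_pair.
have [<-|il] := eqVneq i l; first exact/near34/near23/near_pair.
have [<-|kj] := eqVneq k j; first exact/near12/near23/near_pair.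
have [<-|kl] := eqVneq k l; first exact/near12/near34/near23/near_pair.
have [<-|jl] := eqVneq j l.
  by apply/near12/near23/near12/near34/near23/near_pair.
move: ik ij il kj kl jl; rewrite -!val_eqE /=.
have := ltn_ord i; have := ltn_ord j; have := ltn_ord k; have := ltn_ord l.
clear -n3; lia.
Qed.

End Entries.

Lemma sum_symmetrize n (X F : 'I_n -> 'I_n -> R) : (forall i k, F i k = F k i) ->
  \sum_i \sum_k X i k * F i k = \sum_i \sum_k (2^-1 * (X i k + X k i)) * F i k.
Proof.
move=> Fs.
have E : \sum_i \sum_k X k i * F i k = \sum_i \sum_k X i k * F i k.
  by rewrite exchange_big; apply: eq_bigr => i _; apply: eq_bigr => k _; rewrite Fs.
transitivity (2^-1 * (\sum_i \sum_k X i k * F i k + \sum_i \sum_k X k i * F i k)).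
  by rewrite E; field.
rewrite -big_split mulr_sumr; apply: eq_bigr => i _ /=.
by rewrite -big_split mulr_sumr; apply: eq_bigr => k _ /=; ring.
Qed.

(** On the symmetric part S of X, with N the sum of the squared entries, the model tensor gives lo
    (tr^2 + 2 N). The error is at most lo / 5 times the sum of all |S_ik S_jl|, hence at most lo /
    10 times the sum of all S_ik^2 + S_jl^2; with 9 index pairs this is 18 N lo / 10, less than 2 N
    lo unless N = 0. *)
Lemma near_identity_cat_ge0 (q : 'I_3 -> 'I_3 -> 'I_3 -> 'I_3 -> R) (lo : R) X : 0 < lo ->
  (forall i k j l, q i k j l = q k i j l) -> (forall i k j l, q i k j l = q i k l j) ->
  (forall i k j l, `|q i k j l - lo * ((i == k)%:R * (j == l)%:R
     + (i == j)%:R * (k == l)%:R + (i == l)%:R * (k == j)%:R)| <= lo / 5) ->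
  0 <= \sum_i \sum_k \sum_j \sum_l X i k * X j l * q i k j l.
Proof.
move=> lo0 q12 q34 near; pose S i k := 2^-1 * (X i k + X k i).
have Ss i k : S i k = S k i by rewrite /S addrC.
have -> : \sum_i \sum_k \sum_j \sum_l X i k * X j l * q i k j l =
    \sum_i \sum_k \sum_j \sum_l S i k * S j l * q i k j l.
  transitivity (\sum_i \sum_k X i k * (\sum_j \sum_l X j l * q i k j l)).
    apply: eq_bigr => i _; apply: eq_bigr => k _; rewrite mulr_sumr.
    by apply: eq_bigr => j _; rewrite mulr_sumr; apply: eq_bigr => l _; rewrite mulrA.
  rewrite sum_symmetrize => [|i k]; last first.
    by apply: eq_bigr => j _; apply: eq_bigr => l _; rewrite q12.
  apply: eq_bigr => i _; apply: eq_bigr => k _; rewrite sum_symmetrize => [|j l]; last exact: q34.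
  rewrite mulr_sumr; apply: eq_bigr => j _; rewrite mulr_sumr.
  by apply: eq_bigr => l _; rewrite mulrA.
clearbody S.
pose N := \sum_i \sum_k S i k ^+ 2; pose tr := \sum_i S i i.
pose T i k j l := lo * (S i k * S j l * ((i == k)%:R * (j == l)%:R
     + (i == j)%:R * (k == l)%:R + (i == l)%:R * (k == j)%:R))
     - lo / 10 * (S i k ^+ 2 + S j l ^+ 2).
apply: le_trans (_ : \sum_i \sum_k \sum_j \sum_l T i k j l <= _); last first.
  apply: ler_sum => i _; apply: ler_sum => k _; apply: ler_sum => j _; apply: ler_sum => l _.
  rewrite /T; have := near i k j l; set D := _ + _ + _ => /ler_normlP[h1 h2].
  move: (q i k j l) (S i k) (S j l) D h1 h2 => Q a b D h1 h2.
  have [h|h] := leP 0 (a * b).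
    have : (a * b) * (- (Q - lo * D)) <= (a * b) * (lo / 5) by rewrite ler_wpM2l.
    have : 0 <= lo / 10 * (a - b) ^+ 2 by rewrite mulr_ge0 ?sqr_ge0 ?divr_ge0 ?ltW ?ltr0n.
    by clear -lo0; nra.
  have : - (a * b) * (Q - lo * D) <= - (a * b) * (lo / 5) by rewrite ler_wpM2l // oppr_ge0 ltW.
  have : 0 <= lo / 10 * (a + b) ^+ 2 by rewrite mulr_ge0 ?sqr_ge0 ?divr_ge0 ?ltW ?ltr0n.
  by clear -lo0; nra.
have tr2 : 0 <= lo * tr ^+ 2 by rewrite mulr_ge0 ?sqr_ge0 // ltW.
have N0 : 0 <= lo * N.
  apply: mulr_ge0; first exact: ltW.
  by apply: sumr_ge0 => i _; apply: sumr_ge0 => k _; apply: sqr_ge0.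
have card3 (c : R) : \sum_(j < 3) \sum_(l < 3) c = 9 * c.
  by rewrite !sumr_const !card_ord -mulrnA mulr_natl.
have inner i k : \sum_j \sum_l T i k j l =
    lo * (S i k * ((i == k)%:R * tr) + 2 * S i k ^+ 2) - lo / 10 * (9 * S i k ^+ 2 + N).
  rewrite /T; under eq_bigr do rewrite sumrB; rewrite sumrB; congr (_ - _).
    under eq_bigr do rewrite -mulr_sumr; rewrite -mulr_sumr; congr (_ * _).
    transitivity (\sum_j \sum_l (S i k * (i == k)%:R * ((j == l)%:R * S j l) +
      S i k * (i == j)%:R * ((k == l)%:R * S j l) + S i k * (k == j)%:R * ((i == l)%:R * S j l))).
      by apply: eq_bigr => j _; apply: eq_bigr => l _; ring.
    under eq_bigr do rewrite !big_split /= -!mulr_sumr !sum_delta.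
    rewrite !big_split /= -mulr_sumr -/tr.
    under [X in _ + X + _]eq_bigr do rewrite -mulrA.
    under [X in _ + X]eq_bigr do rewrite -mulrA.
    by rewrite -!mulr_sumr !sum_delta (Ss k i); ring.
  under eq_bigr do rewrite -mulr_sumr; rewrite -mulr_sumr; congr (_ * _).
  by under eq_bigr do rewrite big_split; rewrite big_split /= card3.
suff -> : \sum_i \sum_k \sum_j \sum_l T i k j l = lo * tr ^+ 2 + 2 * (lo * N) - lo / 10 * (18 * N).
  by move: tr2 N0; clear -lo0; move: (lo * tr ^+ 2) => A; nra.
under eq_bigr do under eq_bigr do rewrite inner.
under eq_bigr do rewrite sumrB; rewrite sumrB.
under eq_bigr do rewrite -mulr_sumr; rewrite -mulr_sumr.
under [X in _ - X]eq_bigr do rewrite -mulr_sumr; rewrite -[X in _ - X]mulr_sumr.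
under eq_bigr do rewrite big_split; rewrite big_split /=.
under [X in _ - _ * X]eq_bigr do rewrite big_split; rewrite [X in _ - _ * X]big_split /= card3.
under [X in lo * (_ + X)]eq_bigr do rewrite -mulr_sumr; rewrite -[X in lo * (_ + X)]mulr_sumr -/N.
under [X in _ - _ * (X + _)]eq_bigr do rewrite -mulr_sumr.
rewrite -[X in _ - _ * (X + _)]mulr_sumr -/N.
have -> : \sum_i \sum_k S i k * ((i == k)%:R * tr) = tr * tr.
  transitivity (\sum_i S i i * tr); last by rewrite -mulr_suml.
  apply: eq_bigr => i _.
  rewrite -[RHS](sum_delta i (fun k => S i k * tr)).
  by apply: eq_bigr => k _; ring.
by ring.
Qed.

Lemma ternary_quartic_sos (f : {mpoly R[3]}) (lo M : R) : 0 < lo -> M <= 63 / 20 * lo ->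
  euler 4 f -> (forall x y, sqnorm x = 1 -> sqnorm y = 1 -> lo <= hess f x y <= M) ->
  biform_sos 1 (hess f).
Proof.
move=> lo0 lM f4 hf; apply: cat_form_sos => // X.
apply: (@near_identity_cat_ge0
  (fun i k j l => qf f (bvec R i) (bvec R k) (bvec R j) (bvec R l)) lo X lo0).
- by move=> *; apply: qfC12.
- by move=> *; apply: qfC34.
by move=> i k j l; apply: (qf_near _ lo0 lM f4 hf).
Qed.

End TernaryQuartic.

(** * Collecting the cases *)

Lemma hess_sum n (R : archiRcfType) (phi : {mpoly R[n]} -> R) f (y : 'I_n -> R) :
  linear_for *%R phi ->
  phi (dird y (dird y f)) = \sum_i \sum_j y i * y j * phi (f^`M(i)^`M(j)).
Proof.
move=> phi_lin.
have phi0 : phi 0 = 0 by have := phi_lin (-1) 0 0; rewrite scaler0 addr0 mulN1r addNr.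
have phi_dird q : phi (dird y q) = \sum_i y i * phi q^`M(i).
  rewrite /dird; elim: (index_enum _) => [|i s IH]; first by rewrite !big_nil.
  by rewrite !big_cons -IH -phi_lin.
rewrite phi_dird; apply: eq_bigr => i _; rewrite -dird_mderiv phi_dird mulr_sumr.
by apply: eq_bigr => j _; rewrite mulrA.
Qed.

Lemma wick_inv_hess_sos n (R : archiRcfType) (f : {mpoly R[n]}) (m r : nat) :
  euler m.+2%:R f -> ~~ odd m ->
  (forall x y, 0 <= (wick_inv m r (dird y (dird y f))).@[x]) ->
  biform_sos (m./2 + r) (fun x y => hess f x y * sqnorm x ^+ r).
Proof.
move=> e m_even psi.
have eH i j : euler m%:R (f^`M(i)^`M(j)).
  rewrite (_ : m%:R = m.+2%:R - 1 - 1 :> R); first exact/euler_mderiv/euler_mderiv.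
  by rewrite -[m.+2%:R]natr1 -[m.+1%:R]natr1; ring.
apply: biform_sos_ext (wick_inv_sos (H := fun i j => f^`M(i)^`M(j)) _ eH m_even _) => [x y|i j|x y].
- by rewrite /hess (hess_sum (phi := meval x)) // => c p q; rewrite mevalD mevalZ.
- exact: mderiv_comm.
rewrite -(hess_sum (phi := fun p => (wick_inv m r p).@[x])) => [|c p q].
  exact: psi.
by rewrite linearP mevalD mevalZ.
Qed.

(** [L] stands for ln 2, and [nodes] for the cosines, so that the argument stays algebraic. The
    exponent [r'] is 0 in the quartic cases where the Hessian form is itself a sum of squares; the
    missing powers of |x|^2 are restored later. *)
Theorem hess_sos n (R : archiRcfType) (f : {mpoly R[n]}) (d r : nat) (lo M L : R) :
  (forall mu, exists X : nat -> R, cheb_nodes mu X) ->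
  (1 < n)%N -> (1 < d)%N -> ~~ odd d -> euler d%:R f -> 0 < lo ->
  (forall x y, sqnorm x = 1 -> sqnorm y = 1 -> lo <= hess f x y <= M) ->
  0 < L <= 7 / 10 ->
  n%:R * (d%:R - 2) * (d%:R - 3) / (4 * L * (lo / M)) - (n%:R + d%:R - 2) / 2 - d%:R <= r%:R ->
  exists t r', (r' <= r)%N /\ biform_sos t (fun x y => hess f x y * sqnorm x ^+ r').
Proof.
move=> nodes n1 d1 d_even e lo0 hf /andP[L0 L7] hr.
have n0 := ltnW n1.
have [k dE] : exists k, d = (2 * k).+2 by exists d./2.-1; lia.
have m_even : ~~ odd (2 * k) by rewrite oddM.
rewrite dE in e hr; have ratio := hess_ratio n1 e hf.
have [u u1] := unit_vec R n0; have /andP[h1 h2] := hf u u u1 u1.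
have M0 : 0 < M := lt_le_trans lo0 (le_trans h1 h2).
set N : R := n%:R in hr; set m : R := (2 * k)%:R.
have N2 : 2 <= N by rewrite ler_nat.
have m0 : 0 <= m by rewrite ler0n.
have dR : (2 * k).+2%:R = m + 2 by rewrite -addn2 natrD.
have P0 : 0 <= N * (m * (m - 1)).
  rewrite mulr_ge0 ?ler0n // /m; case: (2 * k)%N => [|j]; first by rewrite mul0r.
  by rewrite mulr_ge0 ?ler0n // subr_ge0 ler1n.
(* 5 / 14 is 1 / (4 L) at L = 7 / 10, and 1 / (4 L) is at least that. *)
have {hr} hr : 5 / 14 * (N * (m * (m - 1)) * M) <= lo * (r%:R + (N + m) / 2 + (m + 2)).
  have h : 5 / 14 * (N * (m * (m - 1)) * M) <=
      lo * (N * (m + 2 - 2) * (m + 2 - 3) / (4 * L * (lo / M))).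
    rewrite [X in _ <= X](_ : _ = (4 * L)^-1 * (N * (m * (m - 1)) * M)); last first.
      by field; rewrite !gt_eqF.
    apply: ler_wpM2r; first by rewrite mulr_ge0 // ltW.
    rewrite -[5 / 14]invrK lef_pV2 ?posrE ?mulr_gt0 ?invr_gt0 ?divr_gt0 ?ltr0n //.
    by rewrite invf_div; lra.
  apply: le_trans h _; rewrite dR in hr; rewrite ler_pM2l //; move: hr.
  by move: (_ / (4 * L * _)) => Z; lra.
have main : (forall x y, 0 <= (wick_inv (2 * k) r (dird y (dird y f))).@[x]) ->
    exists t r', (r' <= r)%N /\ biform_sos t (fun x y => hess f x y * sqnorm x ^+ r').
  by move=> h; exists ((2 * k)./2 + r)%N, r; split=> //; apply: wick_inv_hess_sos.
have small : biform_sos 1 (hess f) ->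
    exists t r', (r' <= r)%N /\ biform_sos t (fun x y => hess f x y * sqnorm x ^+ r').
  move=> h; exists 1%N, 0%N; split=> //; apply: biform_sos_ext h => x y.
  by rewrite expr0 mulr1.
have hess0 x y : 0 <= hess f x y.
  have [a [v [a0 v1 xE]]] := polar x n0; have [b [w [b0 w1 yE]]] := polar y n0.
  have -> : hess f x y = hess f (fun i => a * v i) (fun i => b * w i).
    rewrite /hess (meval_eq _ xE); congr meval.
    by rewrite (dird_ext _ yE) (dird_ext f yE).
  rewrite (hess_scale _ _ _ _ e) mulr_ge0 ?mulr_ge0 ?exprn_ge0 //.
  by have /andP[h _] := hf v w v1 w1; exact: le_trans (ltW lo0) h.
have [k0|k0] := posnP k.
  apply: main => x y; rewrite k0 muln0 /wick_inv big_ord1 expr0 mul1r.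
  by rewrite /inv_coef big_ord0 !expr0 fact0 !mulr1 invr1 mulr1 scale1r; apply: hess0.
have [k1|k1] := eqVneq k 1%N.
  have mE : m = 2 by rewrite /m k1.
  rewrite k1 in e main ratio; rewrite mE in hr.
  have ratio3 : 3 * lo <= M := ratio.
  have loN : lo * N <= N * M / 3.
    have := ler_wpM2l (ler0n R n) ratio3; rewrite -/N; move: (N * M) => A.
    by rewrite mulrCA mulrC; lra.
  have {}hr : 5 / 7 * (N * M) <= lo * r%:R + lo * N / 2 + 5 * lo.
    rewrite (_ : lo * r%:R + _ + _ = lo * (r%:R + (N + 2) / 2 + (2 + 2))); last by field.
    by apply: le_trans hr; rewrite le_eqVlt; apply/orP; left; apply/eqP; field.
  have goalE : lo * (3 * N + 2 * r%:R) = 3 * (lo * N) + 2 * (lo * r%:R) by ring.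
  (* Eliminating r between [hr] and the condition of [wick_inv_quartic_ge0] leaves 10 lo <= 3 / 7 N
     M + 2 lo N to be shown. As M >= 3 lo, it follows from 23 / 7 N >= 10, which holds from N = 4 on
     and just fails for N = 3. *)
  have [n3|n3] := leqP n 3; last first.
    apply: main; apply: (wick_inv_quartic_ge0 (M := M) e hf n0); rewrite -/N.
    have N4 : 4 <= N by rewrite ler_nat.
    have h4 := ler_wpM2r (ltW lo0) N4.
    rewrite goalE [lo * N]mulrC; rewrite [lo * N]mulrC in hr loN.
    by move: hr loN h4; move: (N * M) (N * lo) (lo * r%:R) => A B C; lra.
  have [n2|n2] := eqVneq n 2; last first.
    have n3E : n = 3 by clear -n1 n2 n3; lia.
    have [lM|lM] := leP M (63 / 20 * lo).
      apply: small; clear -n3E lo0 lM e hf; move: f e hf; rewrite n3E => f e hf.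
      exact: ternary_quartic_sos lo0 lM e hf.
    apply: main; apply: (wick_inv_quartic_ge0 (M := M) e hf n0); rewrite -/N.
    have N3 : N = 3 by rewrite /N n3E.
    by rewrite goalE; move: hr lM; rewrite N3; move: (lo * r%:R) => C; lra.
  apply: small; clear -n2 e hess0; move: f e hess0; rewrite n2 => f e hess0.
  exact: binary_quartic_sos e hess0.
have k2 : (2 <= k)%N by clear -k0 k1; lia.
apply: main; apply: wick_inv_dird_ge0 => // v v1.
have ev : euler (2 * k)%:R (dird v (dird v f)).
  rewrite (_ : (2 * k)%:R = (2 * k).+2%:R - 1 - 1 :> R); first exact/euler_dird/euler_dird.
  by rewrite -[(2 * k).+2%:R]natr1 -[(2 * k).+1%:R]natr1; ring.
apply: (wick_inv_ge0 nodes m_even _ n0 ev lo0 (M := M)) => [|z z1|].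
- by rewrite muln_gt0.
- exact: hf.
have PE : (n * ff2 (2 * k))%:R = N * (m * (m - 1)).
  by rewrite natrM natr_ff2.
have m4 : 4 <= m by rewrite /m ler_nat; clear -k2; lia.
have Q : (n * ff2 (2 * k - 2))%:R <= N * (m * (m - 1)).
  by rewrite -PE ler_nat leq_mul2l /ff2 leq_mul ?orbT //; clear; lia.
(* Eight times [hr], compared with the condition of [wick_inv_ge0], leaves lo P + 8 lo m + 16 lo <=
   6 / 7 P M to be shown, where P = N m (m - 1). By M >= 5 lo and m >= 4 it is enough that 12 m <=
   23 / 7 P, and P >= 6 m. *)
have ratio5 : 5 * lo <= M.
  apply: le_trans ratio; rewrite ler_pM2r // ler_nat; clear -k2; lia.
have P6 : 6 * m <= N * (m * (m - 1)).
  rewrite mulrCA mulrC ler_wpM2l //; move: N2 m4; clear; nra.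
rewrite PE; set P := N * (m * (m - 1)) in hr P0 Q P6 *.
have a1 := ler_wpM2l P0 ratio5.
have a2 := ler_wpM2l (ltW lo0) P6.
have a3 := ler_wpM2l (ltW lo0) m4.
have a4 := ler_wpM2l (ltW lo0) Q.
have -> : 4 * lo * (n + 2 * k + 2 * r)%:R = 4 * (lo * N) + 4 * (lo * m) + 8 * (lo * r%:R).
  by rewrite (natrD _ (n + 2 * k)) (natrD _ n) (natrM _ 2 r) -/N -/m; ring.
have {}hr : 5 / 14 * (P * M) <= lo * r%:R + (lo * N + lo * m) / 2 + lo * m + 2 * lo.
  by rewrite (_ : _ + 2 * lo = lo * (r%:R + (N + m) / 2 + (m + 2))) //; field.
rewrite mulrCA in a1; rewrite mulrCA in a2; rewrite [lo * P]mulrC in a2 a4.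
rewrite -[2 * M * P]mulrA [M * P]mulrC; move: (_%:R) a4 => Z a4.
move: hr a1 a2 a3 a4 lo0; clear.
move: (P * M) (P * lo) (lo * m) (lo * N) (lo * r%:R) (lo * Z) => A B C D E F.
lra.
Qed.

(** * Cosine nodes and a bound on ln 2 over the standard reals *)

Local Notation R := Rdefinitions.R.

Section ChebyshevNodes.

Lemma cheb_cos k (t : R) : (cheb R k).[cos t] = cos (k%:R * t)%R.
Proof.
suff : (cheb R k).[cos t] = cos (k%:R * t)%R /\ (cheb R k.+1).[cos t] = cos (k.+1%:R * t)%R by case.
elim: k => [|k [IH1 IH2]]; first by rewrite /= !hornerE cos_0.
split=> //; rewrite chebSS !hornerE IH1 IH2 /=.
have -> : k.+2%:R * t = k.+1%:R * t + t by rewrite -[k.+2%:R]natr1 mulrDl mul1r.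
have -> : k%:R * t = k.+1%:R * t - t by rewrite -[k.+1%:R]natr1 mulrDl mul1r addrK.
have cN : cos (- t)%R = cos t := cos_neg t.
have sN : sin (- t)%R = - sin t := sin_neg t.
rewrite !cosD cN sN.
by ring.
Qed.

Lemma cos_nat_pi j : cos (j%:R * PI)%R = (-1) ^+ j.
Proof.
elim: j => [|j IH]; first by rewrite mul0r cos_0.
by rewrite -natr1 mulrDl mul1r exprS mulN1r -IH; apply: neg_cos.
Qed.

Lemma exists_cheb_nodes mu : exists X : nat -> R, cheb_nodes mu X.
Proof.
exists (fun j => cos (j%:R * PI / mu%:R)%R).
have PI0 : 0 < PI by apply/RltP; exact: PI_RGT_0.
have rng j : (j <= mu)%N -> (0 <= j%:R * PI / mu%:R <= PI) .
  move=> jmu; have [mu0|mu0] := posnP mu.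
    by rewrite mu0 invr0 mulr0 lexx ltW.
  apply/andP; split.
    by apply: divr_ge0; [apply: mulr_ge0; [exact: ler0n | exact: ltW] | exact: ler0n].
  by rewrite ler_pdivrMr ?ltr0n // mulrC ler_pM2l // ler_nat.
split.
- by rewrite !mul0r cos_0.
- move=> i j /andP[ij jmu]; have mu0 : (0 < mu)%N by lia.
  have /andP[/RleP a1 /RleP a2] := rng i (ltnW (leq_trans ij jmu)).
  have /andP[/RleP b1 /RleP b2] := rng j jmu.
  apply/RltP; apply: cos_decreasing_1 => //; apply/RltP.
  by rewrite ltr_pM2r ?invr_gt0 ?ltr0n // ltr_pM2r // ltr_nat.
- by move=> j _; apply/RleP; have [] := COS_bound (j%:R * PI / mu%:R).
move=> j jmu; rewrite cheb_cos.
have [mu0|mu0] := posnP mu.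
  by move: jmu; rewrite mu0 leqn0 => /eqP ->; rewrite !mul0r cos_0.
by rewrite mulrCA divff ?mulr1 ?pnatr_eq0 -?lt0n // cos_nat_pi.
Qed.

Lemma ln2_bounds : 0 < ln 2%R <= 7 / 10.
Proof.
have step (a b t : R) : a <= exp t -> 0 <= a -> b <= a * a -> b <= exp (t *+ 2)%R.
  move=> at_ a0 ba; apply: le_trans ba _.
  by rewrite mulr2n -expRD; apply: ler_pM.
have e7 : 2 <= exp (7 / 10)%R.
  (* t is 7 / 10 divided by 2^6: start from 1 + t <= exp t and square six times, rounding each
     square down to a fraction with small terms. *)
  have [t tE] : exists t : R, t = 7 / 640 by eexists.
  have h0 : 1 + t <= exp t by have /RleP := exp_ineq1_le t; rewrite RplusE R1E.
  have h1 : 93 / 91 <= exp (t *+ 2)%R by apply: step h0 _ _; rewrite tE; lra.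
  have h2 : 400 / 383 <= exp (t *+ 2 *+ 2)%R by apply: step h1 _ _; lra.
  have h3 : 433 / 397 <= exp (t *+ 2 *+ 2 *+ 2)%R by apply: step h2 _ _; lra.
  have h4 : 251 / 211 <= exp (t *+ 2 *+ 2 *+ 2 *+ 2)%R by apply: step h3 _ _; lra.
  have h5 : 508 / 359 <= exp (t *+ 2 *+ 2 *+ 2 *+ 2 *+ 2)%R by apply: step h4 _ _; lra.
  rewrite (_ : 7 / 10 = t *+ 2 *+ 2 *+ 2 *+ 2 *+ 2 *+ 2); first by apply: step h5 _ _; lra.
  by rewrite tE -!mulrnA -mulr_natl; field.
apply/andP; split.
  have h : Rlt (ln 1) (ln 2%R).
    by apply: ln_increasing; apply/RltP; [exact: ltr01 | exact: ltr1n].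
  by move: h; rewrite ln_1 => /RltP.
rewrite leNgt; apply/negP => /RltP/exp_increasing; rewrite exp_ln; last by apply/RltP; exact: ltr0n.
by move/RltP; rewrite ltNge e7.
Qed.

End ChebyshevNodes.

(** * Polynomials of the statement *)

Section Bridge.

Definition mpoly_of n (p : Defs.mpoly) : {mpoly R[n]} :=
  \sum_(c <- p) c.1 *: 'X_[[multinom c.2 i | i < n]].

Lemma sumRE n g : sumR n g = \sum_(i < n) g i.
Proof.
rewrite /sumR; suff h a : List.fold_right Rplus (IZR 0) (List.map g (List.seq a n)) =
    \sum_(i < n) g (a + i)%N by rewrite h; apply: eq_bigr => i _; rewrite add0n.
elim: n a => [|n IH] a /=; first by rewrite big_ord0.
rewrite IH big_ord_recl addn0; congr (_ + _); apply: eq_bigr => i _.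
by rewrite lift0 addSnnS.
Qed.

Lemma prodRE n g : prodR n g = \prod_(i < n) g i.
Proof.
rewrite /prodR; suff h a : List.fold_right Rmult (IZR 1) (List.map g (List.seq a n)) =
    \prod_(i < n) g (a + i)%N by rewrite h; apply: eq_bigr => i _; rewrite add0n.
elim: n a => [|n IH] a /=; first by rewrite big_ord0.
rewrite IH big_ord_recl addn0; congr (_ * _); apply: eq_bigr => i _.
by rewrite lift0 addSnnS.
Qed.

Lemma eval_monE n c x : eval_mon n c x = c.1 * \prod_(i < n) x i ^+ c.2 i.
Proof.
by rewrite /eval_mon prodRE; congr (_ * _); apply: eq_bigr => i _; rewrite RpowE.
Qed.

Lemma evalE n p x : eval n p x = (mpoly_of n p).@[fun i => x i].
Proof.
rewrite /eval /mpoly_of raddf_sum; elim: p => [|c p IH] /=; first by rewrite big_nil.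
rewrite big_cons -IH /= mevalZ mevalX eval_monE; congr (_ * _ + _).
by apply: eq_bigr => i _; rewrite mnmE.
Qed.

Lemma mpoly_of_dpoly n (i : 'I_n) p : mpoly_of n (dpoly i p) = (mpoly_of n p)^`M(i).
Proof.
rewrite /mpoly_of linear_sum /=; elim: p => [|c p IH] /=; first by rewrite !big_nil.
rewrite !big_cons IH; congr (_ + _); rewrite linearZ /= mderivX scalerA mnmE INRE.
congr (_ *: 'X_[_]); apply/mnmP => j; rewrite mnmBE !mnmE.
rewrite -val_eqE /= eq_sym; case: PeanoNat.Nat.eqb_spec => [->|/eqP/negbTE ->].
  by rewrite eqxx; lia.
by rewrite subn0.
Qed.

Lemma hess_formE n f x y :
  hess_form n f x y = hess (mpoly_of n f) (fun i => x i) (fun i => y i).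
Proof.
rewrite /hess (hess_sum (phi := meval _)) => [|c p q]; last by rewrite mevalD mevalZ.
rewrite /hess_form sumRE; apply: eq_bigr => i _; rewrite sumRE; apply: eq_bigr => j _.
rewrite /hessian evalE !mpoly_of_dpoly mderiv_comm.
by rewrite !RmultE mulrAC.
Qed.

Lemma on_sphereE n x : on_sphere n x <-> sqnorm (fun i : 'I_n => x i) = 1.
Proof.
rewrite /on_sphere sumRE /sqnorm.
by rewrite (eq_bigr (fun i : 'I_n => x i ^+ 2)) // => i _; rewrite RpowE.
Qed.

Lemma is_form_euler n d f : is_form n d f -> euler d%:R (mpoly_of n f).
Proof.
move=> h; apply: dhomog_euler; rewrite /mpoly_of.
elim: f h => [|c f IH] h; first by rewrite big_nil; apply: rpred0.
rewrite big_cons; apply: rpredD; last by apply: IH => c' fc'; apply: h; right.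
apply: rpredZ; rewrite dhomogX /= mdegE.
have <- : List.fold_right addn 0%N (List.map c.2 (List.seq 0 n)) = d by apply: h; left.
apply/eqP; suff E a : List.fold_right addn 0%N (List.map c.2 (List.seq a n)) =
    (\sum_(i < n) c.2 (a + i))%N.
  by rewrite E; apply: eq_bigr => i _; rewrite mnmE add0n.
elim: {IH h} n a => [|n IH] a /=; first by rewrite big_ord0.
rewrite IH big_ord_recl addn0; congr addn; apply: eq_bigr => i _.
by rewrite lift0 addSnnS.
Qed.

End Bridge.


(** * Sums of squares as lists of monomials *)

Section SumsOfSquares.

Lemma sum_listE A (s : seq A) (g : A -> R) :
  List.fold_right Rplus (IZR 0) (List.map g s) = \sum_(a <- s) g a.
Proof. by elim: s => [|a s IH] /=; rewrite ?big_nil // big_cons IH. Qed.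

Lemma is_sos_2nE n P : is_sos_2n n P <-> exists qs : seq Defs.mpoly,
  forall x y, P x y = \sum_(q <- qs) eval (2 * n) q (pair_vec n x y) ^+ 2.
Proof.
by split=> -[qs h]; exists qs => x y; rewrite h sum_listE; apply: eq_bigr => q _;
  rewrite RpowE.
Qed.

Lemma eval_sumE n p v : eval n p v = \sum_(c <- p) c.1 * \prod_(i < n) v i ^+ c.2 i.
Proof. by rewrite /eval sum_listE; apply: eq_bigr => c _; rewrite eval_monE. Qed.

Lemma big_pair_vec n (x y : nat -> R) (e : nat -> nat) :
  \prod_(i < 2 * n) pair_vec n x y i ^+ e i =
  (\prod_(i < n) x i ^+ e i) * \prod_(i < n) y i ^+ e (n + i)%N.
Proof.
have -> : \prod_(i < 2 * n) pair_vec n x y i ^+ e i =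
    \prod_(i < n + n) pair_vec n x y i ^+ e i by rewrite addnn -mul2n.
rewrite big_split_ord /=; congr (_ * _); apply: eq_bigr => i _; rewrite /pair_vec.
  by case: PeanoNat.Nat.ltb_spec => // /ssrnat.leP; rewrite leqNgt ltn_ord.
case: PeanoNat.Nat.ltb_spec => [/ssrnat.leP|_]; first by rewrite ltnNge leq_addr.
by rewrite (_ : Nat.sub _ _ = i) //; lia.
Qed.

Definition mul_var (i : nat) (q : Defs.mpoly) : Defs.mpoly :=
  [seq (c.1, fun k => (c.2 k + (k == i))%N) | c <- q].

Lemma eval_mul_var n i q v : (i < n)%N -> eval n (mul_var i q) v = v i * eval n q v.
Proof.
move=> ni; rewrite !eval_sumE big_map mulr_sumr; apply: eq_bigr => c _ /=.
rewrite [RHS]mulrCA; congr (_ * _).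
under eq_bigr do rewrite exprD.
rewrite big_split mulrC /=; congr (_ * _).
rewrite (bigD1 (Ordinal ni)) //= eqxx big1 ?mulr1 // => j.
by rewrite -val_eqE /= => /negbTE ->.
Qed.

Lemma is_sos_2n_ext n P Q : (forall x y, P x y = Q x y) -> is_sos_2n n P -> is_sos_2n n Q.
Proof. by move=> PQ [qs h]; exists qs => x y; rewrite -PQ. Qed.

(** The product of a sum of q^2 and a sum of x_i^2 is the sum of all (x_i q)^2. *)
Lemma is_sos_2n_mul_sqnorm n P k : is_sos_2n n P ->
  is_sos_2n n (fun x y => P x y * sqnorm (fun i : 'I_n => x i) ^+ k).
Proof.
elim: k P => [|k IH] P h.
  by apply: is_sos_2n_ext h => x y; rewrite expr0 mulr1.
apply: is_sos_2n_ext (_ : is_sos_2n n (fun x y =>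
  (P x y * sqnorm (fun i : 'I_n => x i)) * sqnorm (fun i : 'I_n => x i) ^+ k)) => [x y|].
  by rewrite exprS mulrA.
apply: IH; move: h => /is_sos_2nE[qs h]; apply/is_sos_2nE.
exists [seq mul_var (i : 'I_n) q | i <- enum 'I_n, q <- qs] => x y.
rewrite big_allpairs_dep big_enum /= /sqnorm h mulr_sumr; apply: eq_bigr => i _.
rewrite mulr_suml; apply: eq_bigr => q _.
have i2 : (i < 2 * n)%N by rewrite mul2n -addnn ltn_addr.
rewrite (eval_mul_var _ _ i2) exprMn mulrC; congr (_ ^+ 2 * _); rewrite /pair_vec.
by case: PeanoNat.Nat.ltb_spec => // /ssrnat.leP; rewrite leqNgt ltn_ord.
Qed.

Definition bimon_exp n t (a : 'I_n * {ffun 'I_t -> 'I_n}) (k : nat) : nat :=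
  if (k < n)%N then #|[pred l | a.2 l == k :> nat]| else (k == (n + a.1)%N).

Lemma bimon_pair_vec n t (a : 'I_n * {ffun 'I_t -> 'I_n}) (x y : nat -> R) :
  \prod_(i < 2 * n) pair_vec n x y i ^+ bimon_exp a i =
  bimon a (fun i => x i) (fun i => y i).
Proof.
rewrite big_pair_vec mulrC /bimon /bimon_exp; congr (_ * _).
  rewrite (bigD1 a.1) //= ltnNge leq_addr /= eqxx big1 ?mulr1 // => i ia.
  by rewrite ltnNge leq_addr /= eqn_add2l val_eqE (negbTE ia).
rewrite (partition_big (fun k => a.2 k) predT) //=; apply: eq_bigr => i _.
rewrite ltn_ord (eq_bigr (fun=> x i)) => [|l /eqP -> //].
by rewrite prodr_const; congr (_ ^+ _).
Qed.

Lemma biform_sos_is_sos_2n n t (P : ('I_n -> R) -> ('I_n -> R) -> R) :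
  biform_sos t P -> is_sos_2n n (fun x y => P (fun i => x i) (fun i => y i)).
Proof.
case=> L h; apply/is_sos_2nE.
exists [seq [seq (c a, bimon_exp a) | a <- enum {: 'I_n * {ffun 'I_t -> 'I_n}}] | c <- L] => x y.
rewrite h big_map; apply: eq_bigr => c _; congr (_ ^+ 2).
by rewrite eval_sumE big_map big_enum; apply: eq_bigr => a _; rewrite /= bimon_pair_vec.
Qed.

(** The statement quantifies over sequences, of which the Hessian form and the sphere read only the
    first [n] values, so padding a vector with zeros loses nothing. *)
Definition extend0 n (v : 'I_n -> R) (k : nat) : R := oapp v 0 (insub k).

Lemma extend0E n (v : 'I_n -> R) : (fun i : 'I_n => extend0 v i) =1 v.
Proof. by move=> i; rewrite /extend0 valK. Qed.

End SumsOfSquares.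

Lemma r_sos_convex_of_bound n d f m M r :
  le 2 n -> le 2 d -> Nat.Even d -> is_form n d f ->
  (forall x y, on_sphere n x -> on_sphere n y -> Rlt (IZR 0) (hess_form n f x y)) ->
  is_min_on_sphere2 n (hess_form n f) m ->
  is_max_on_sphere2 n (hess_form n f) M ->
  Rge (INR r) (Rminus (Rminus
    (Rdiv (Rmult (Rmult (INR n) (Rminus (INR d) (IZR 2))) (Rminus (INR d) (IZR 3)))
          (Rmult (Rmult (IZR 4) (ln (IZR 2))) (Rdiv m M)))
    (Rdiv (Rminus (Rplus (INR n) (INR d)) (IZR 2)) (IZR 2))) (INR d)) ->
  r_sos_convex n r f.
Proof.
move=> /ssrnat.leP n2 /ssrnat.leP d2 [d' dE] fd pos [[x0 [y0 [sx0 [sy0 mE]]]] lom] [_ hiM] hr.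
have m0 : 0 < m by rewrite -mE; apply/RltP; apply: pos.
have d_even : ~~ odd d by rewrite dE multE oddM.
have hessE (u v : 'I_n -> R) :
    hess (mpoly_of n f) u v = hess_form n f (extend0 u) (extend0 v).
  rewrite hess_formE; congr hess; apply/boolp.funext => i; exact/esym/extend0E.
have sph (u : 'I_n -> R) : sqnorm u = 1 -> on_sphere n (extend0 u).
  by move=> su; apply/on_sphereE; rewrite -su; apply: eq_bigr => i _; rewrite extend0E.
have bounds (u v : 'I_n -> R) : sqnorm u = 1 -> sqnorm v = 1 -> m <= hess (mpoly_of n f) u v <= M.
  move=> /sph su /sph sv; rewrite hessE.
  by apply/andP; split; apply/RleP; [apply: lom | apply: hiM].
have I3 : IZR 3 = 3%:R by rewrite -[3%:R]INRE /=; Lra.lra.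
have I4 : IZR 4 = 4%:R by rewrite -[4%:R]INRE /=; Lra.lra.
have I2 : IZR 2 = 2%:R by rewrite -[2%:R]INRE /=; Lra.lra.
have hr' : n%:R * (d%:R - 2) * (d%:R - 3) / (4 * ln 2%R * (m / M)) - (n%:R + d%:R - 2) / 2 - d%:R
     <= r%:R :> R.
  by move: hr => /Rge_le/RleP; rewrite I2 I3 I4 !INRE.
have [t [r' [r'r hs]]] := hess_sos exists_cheb_nodes n2 d2 d_even (is_form_euler fd)
  m0 bounds ln2_bounds hr'.
have := is_sos_2n_mul_sqnorm (r - r') (biform_sos_is_sos_2n hs).
apply: is_sos_2n_ext => x y; rewrite hess_formE -mulrA -exprD subnKC //.
rewrite RmultE RpowE sumRE; congr (_ * _ ^+ _).
by apply: eq_bigr => i _; rewrite RpowE.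
Qed.

End SosConvexity.

Theorem theorem5 (n d : nat) (f : mpoly) (m M : R) (r : nat) :
  (2 <= n)%nat -> (2 <= d)%nat -> Nat.Even d ->
  is_form n d f ->
  (forall x y, on_sphere n x -> on_sphere n y -> 0 < hess_form n f x y) ->
  is_min_on_sphere2 n (hess_form n f) m ->
  is_max_on_sphere2 n (hess_form n f) M ->
  INR r >= INR n * (INR d - 2) * (INR d - 3) / (4 * ln 2 * (m / M))
           - (INR n + INR d - 2) / 2 - INR d ->
  r_sos_convex n r f.
Proof. exact (@SosConvexity.r_sos_convex_of_bound n d f m M r). Qed.
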